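(* Every oriented bicircular matroid is $coGSP$. That is, if $O$ is an oriented matroid whose underlying matroid is the bicircular matroid $B(G)$ of some graph $G$, then $O$ is $coGSP$.
   Context: Graphs are finite and may have loops and parallel edges. For a set $I$ of edges of $G$, $G[I]$ is the subgraph with edge set $I$ and no isolated vertices. The bicircular matroid $B(G)$ is the matroid on the edge set $E$ of $G$ whose independent sets are the sets $I\subseteq E$ such that every connected component of $G[I]$ contains at most one cycle (loops and pairs of parallel edges count as cycles). Let $O$ be an oriented matroid on a finite set $E$. The signed vector of a signed circuit $C=(C^+,C^-)$ is the vector in $\{0,1,-1\}^E$ that equals $1$ on $C^+$, $-1$ on $C^-$ and $0$ elsewhere. The flow lattice $\mathcal{F}_O$ is the set of all integer linear combinations of signed vectors of signed circuits of $O$; its elements are the flows of $O$. A $\{0,1,-1\}$-flow is a flow all of whose entries lie in $\{0,1,-1\}$. A (oriented) matroid is cosimple if the dual of its underlying matroid is simple. An oriented matroid $O$ is $coGSP$ if every cosimple minor of $O$ with nonempty ground set has a nonzero $\{0,1,-1\}$-flow with at most two non-zero entries. *)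

(* Defs.v *)
From HB Require Import structures.
From mathcomp Require Import all_boot all_order all_algebra.

Set Implicit Arguments.
Unset Strict Implicit.
Unset Printing Implicit Defensive.

Import GRing.Theory.

(** * Matroids *)

(** Only the data of a matroid is recorded: a ground set inside an ambient
    finite type and the family of independent sets. *)
Record matroid (T : finType) := Matroid {
  ground : {set T};
  indep : {set {set T}}
}.

Section Matroids.
Variable T : finType.
Implicit Type M : matroid T.

Definition circuits M : {set {set T}} :=
  [set C | minset (fun D : {set T} => (D \subset ground M) && (D \notin indep M)) C].

Definition bases M : {set {set T}} :=
  [set B | maxset (fun I : {set T} => I \in indep M) B].

Definition dual_bases M : {set {set T}} := [set ground M :\: B | B in bases M].

Definition dual M : matroid T :=
  Matroid (ground M)
          [set I : {set T} | [exists B in dual_bases M, I \subset B]].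

(** No loops and no parallel pairs. *)
Definition simple M : Prop :=
  (forall e, [set e] \notin circuits M) /\
  (forall e f, e != f -> [set e; f] \notin circuits M).

Definition cosimple M : Prop := simple (dual M).

End Matroids.

(** * Oriented matroids *)

(** A signed set [X] is the pair of its positive part [X.1] and its negative
    part [X.2]; disjointness of the two is part of [oriented_matroid]. *)
Notation signed_set T := ({set T} * {set T})%type.

Section SignedSets.
Variable T : finType.
Implicit Type X : signed_set T.

Definition supp X : {set T} := X.1 :|: X.2.
Definition sopp X : signed_set T := (X.2, X.1).
Definition sdiff X (A : {set T}) : signed_set T := (X.1 :\: A, X.2 :\: A).

Definition signed_vector X : {ffun T -> int} :=
  [ffun e => if e \in X.1 then 1 else if e \in X.2 then -1 else 0]%R.

End SignedSets.

Record signed_system (T : finType) := SignedSystem {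
  sground : {set T};
  scircuits : {set signed_set T}
}.

Section OrientedMatroids.
Variable T : finType.
Implicit Types (O : signed_system T) (A B : {set T}).

Record oriented_matroid O : Prop := {
  om_signed : forall X, X \in scircuits O -> [disjoint X.1 & X.2];
  om_ground : forall X, X \in scircuits O -> supp X \subset sground O;
  om_nonempty : forall X, X \in scircuits O -> supp X != set0;
  om_symmetric : forall X, X \in scircuits O -> sopp X \in scircuits O;
  om_incomparable : forall X Y, X \in scircuits O -> Y \in scircuits O ->
    supp X \subset supp Y -> X = Y \/ X = sopp Y;
  om_elimination : forall X Y e, X \in scircuits O -> Y \in scircuits O ->
    X <> sopp Y -> e \in X.1 :&: Y.2 ->
    exists Z, [/\ Z \in scircuits O,
                  Z.1 \subset (X.1 :|: Y.1) :\ e &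
                  Z.2 \subset (X.2 :|: Y.2) :\ e]
}.

Definition underlying O : matroid T :=
  Matroid (sground O)
          [set I : {set T} | (I \subset sground O) &&
                             [forall X in scircuits O, ~~ (supp X \subset I)]].

Definition delete O A : signed_system T :=
  SignedSystem (sground O :\: A)
               [set X in scircuits O | supp X \subset sground O :\: A].

(** The signed circuits of [contract O A] are the support-minimal nonempty
    restrictions of signed circuits of [O] to the complement of [A]. *)
Definition contract O A : signed_system T :=
  let R := [set sdiff X A | X in scircuits O & supp (sdiff X A) != set0] in
  SignedSystem (sground O :\: A)
               [set Y in R | [forall Z in R,
                  (supp Z \subset supp Y) ==> (supp Z == supp Y)]].

Definition is_minor O' O : Prop :=
  exists A B, [/\ A \subset sground O, B \subset sground O,
                  [disjoint A & B] & O' = delete (contract O A) B].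

Definition is_flow O (f : {ffun T -> int}) : Prop :=
  exists a : signed_set T -> int,
    f = (\sum_(X in scircuits O) signed_vector X *~ a X)%R.

Definition sign_valued (f : {ffun T -> int}) : Prop :=
  forall e, f e \in [:: 0; 1; -1]%R.

Definition coGSP O : Prop :=
  forall O', is_minor O' O -> cosimple (underlying O') -> sground O' != set0 ->
  exists f : {ffun T -> int},
    [/\ is_flow O' f, sign_valued f, f <> 0%R &
        #|[set e | f e != 0%R]| <= 2].

End OrientedMatroids.

(** * Graphs and bicircular matroids *)

(** Loops and parallel edges are allowed; the order of the two ends of an edge
    is an artefact of the encoding and is never used. *)
Record graph := Graph {
  vertex : finType;
  edge : finType;
  ends : edge -> vertex * vertex
}.

Section Bicircular.
Variable G : graph.
Implicit Types (I C K : {set edge G}) (u v : vertex G).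

(** A loop is incident twice with its end. *)
Definition incidence (e : edge G) v : nat :=
  ((ends e).1 == v) + ((ends e).2 == v).

(** The vertices of the subgraph [G[I]], which has no isolated vertices. *)
Definition vertices I : {set vertex G} :=
  [set v | [exists e in I, 0 < incidence e v]].

Definition adjacent I : rel (vertex G) := fun u v =>
  [exists e in I, (ends e == (u, v)) || (ends e == (v, u))].

Definition connected I : bool :=
  [forall u in vertices I, forall v in vertices I, connect (adjacent I) u v].

(** Edge sets of connected components of [G[I]]; these determine the
    components, since no vertex of [G[I]] is isolated. *)
Definition component I v : {set edge G} :=
  [set e in I | connect (adjacent I) v (ends e).1].

Definition components I : {set {set edge G}} :=
  [set component I v | v in vertices I].

Definition degree I v : nat := \sum_(e in I) incidence e v.

(** Edge sets of cycles, that is of nonempty connected 2-regular subgraphs;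
    a loop and a pair of parallel edges are cycles. *)
Definition is_cycle C : bool :=
  [&& C != set0, connected C & [forall v in vertices C, degree C v == 2]].

Definition at_most_one_cycle K : bool :=
  [forall C1 : {set edge G}, forall C2 : {set edge G},
     [&& is_cycle C1, C1 \subset K, is_cycle C2 & C2 \subset K] ==> (C1 == C2)].

Definition bicircular : matroid (edge G) :=
  Matroid setT
          [set I : {set edge G} | [forall K in components I, at_most_one_cycle K]].

End Bicircular.

(* Main.v *)
Require Import Defs.
From HB Require Import structures.
From mathcomp Require Import all_boot all_order all_algebra.
From mathcomp Require Import zify ring.
From Stdlib Require Import Classical.

(** If two signed circuits [X] and [Y] satisfy [X \ Y = {e}] and [Y \ X = {f}],
    their union has nullity two; going from [X] to [Y] by eliminating, one after
    the other, the elements on which the two disagree, one gets a flow with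
    entries 1 or -1 on [e] and [f] and 0 elsewhere. So it suffices to find two
    circuits exchanging a single element, or a circuit with at most two elements.

    Independence in [B(G)] is Hall's condition for the family of the end sets of
    the edges. Families of sets of size at most two are stable under contraction,
    hence so is this description. If the minor is cosimple, at least three edges
    meet each vertex. Take a longest path [v_0 ... v_k] whose first end has a
    neighbour [v_j] with [j] as large as possible. On the cycle [v_0 ... v_j],
    both neighbours of [v_j] are ends of such paths, so all their edges are spanned
    by the cycle. If the cycle spans two further edges [b] and [d], adding one or
    the other gives two circuits. Otherwise [j <= 2] and the cycle is
    attached to the rest of the graph at [v_j] only; cosimplicity then
    yields a path from [v_j] to a second cycle, which closes up two different
    unicyclic subgraphs at [v_j]. *)

Set Implicit Arguments.
Unset Strict Implicit.
Unset Printing Implicit Defensive.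

Import Order.TTheory GRing.Theory Num.Theory.

(** * Flows from a pair of circuits *)

Section Signs.
Variable T : finType.
Implicit Types (O : signed_system T) (X Y Z : signed_set T) (A : {set T}).

Definition wf X := [disjoint X.1 & X.2].

Lemma sv_values X e : signed_vector X e \in [:: 0; 1; -1]%R.
Proof. by rewrite ffunE; case: ifP => // _; case: ifP. Qed.

Lemma sv_pos X e : (signed_vector X e == 1%R) = (e \in X.1).
Proof. by rewrite ffunE; case: ifP => // _; case: ifP. Qed.

Lemma sv_neg X e : wf X -> (signed_vector X e == (-1)%R) = (e \in X.2).
Proof.
move=> dX; rewrite ffunE; case: ifP => [e1|_]; last by case: ifP.
by rewrite (disjointFr dX e1).
Qed.

Lemma sv_neq0 X e : (signed_vector X e != 0%R) = (e \in supp X).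
Proof. by rewrite ffunE inE; case: ifP => // _; case: ifP. Qed.

Lemma sv_eq0 X e : e \notin supp X -> signed_vector X e = 0%R.
Proof. by rewrite -sv_neq0 negbK => /eqP. Qed.

Lemma sv_supp X e : e \in supp X ->
  signed_vector X e = 1%R \/ signed_vector X e = (-1)%R.
Proof.
by rewrite -sv_neq0; have := sv_values X e; rewrite !inE => /or3P[]/eqP->; auto.
Qed.

Lemma sv_opp X e : wf X -> signed_vector (sopp X) e = (- signed_vector X e)%R.
Proof.
move=> dX; rewrite !ffunE /=; case: ifP => [e2|_]; last by case: ifP; rewrite ?oppr0.
by rewrite (disjointFl dX e2) opprK.
Qed.

Lemma supp_opp X : supp (sopp X) = supp X.
Proof. by rewrite /supp setUC. Qed.

Lemma soppK X : sopp (sopp X) = X.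
Proof. by case: X. Qed.

Lemma sv_diff X A e :
  signed_vector (sdiff X A) e = if e \in A then 0%R else signed_vector X e.
Proof. by rewrite !ffunE !inE; case: (e \in A). Qed.

Lemma supp_diff X A : supp (sdiff X A) = supp X :\: A.
Proof. by rewrite /supp setDUl. Qed.

Lemma wf_diff X A : wf X -> wf (sdiff X A).
Proof.
by move=> dX; apply: disjointWl (subsetDl _ _) _; apply: disjointWr (subsetDl _ _) _.
Qed.

Lemma sopp_diff X A : sopp (sdiff X A) = sdiff (sopp X) A.
Proof. by []. Qed.

Lemma sv_inj X Y : wf X -> wf Y ->
  (forall e, signed_vector X e = signed_vector Y e) -> X = Y.
Proof.
case: X Y => [X1 X2] [Y1 Y2] wX wY eXY; congr (_, _); apply/setP => e.
  by rewrite -(sv_pos (X1, X2)) -(sv_pos (Y1, Y2)) eXY.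
by rewrite -(sv_neg e wX) -(sv_neg e wY) eXY.
Qed.

Lemma om_wf O X : oriented_matroid O -> X \in scircuits O -> wf X.
Proof. by move=> oO; apply: om_signed. Qed.

(** Axiom [om_elimination], insensitive to which of the two signs is positive. *)
Lemma elimination O X Y e : oriented_matroid O ->
    X \in scircuits O -> Y \in scircuits O -> X <> sopp Y ->
    e \in supp X -> signed_vector X e = (- signed_vector Y e)%R ->
  exists Z, [/\ Z \in scircuits O, e \notin supp Z &
    forall h, h \in supp Z -> signed_vector Z h = signed_vector X h \/
                              signed_vector Z h = signed_vector Y h].
Proof.
move=> oO XO YO nXY eX eXY; have [wX wY] := (om_wf oO XO, om_wf oO YO).
have key X' Y' : X' \in scircuits O -> Y' \in scircuits O -> X' <> sopp Y' ->
    e \in X'.1 :&: Y'.2 ->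
    exists Z, [/\ Z \in scircuits O, e \notin supp Z &
    forall h, h \in supp Z -> signed_vector Z h = signed_vector X' h \/
                              signed_vector Z h = signed_vector Y' h].
  move=> XO' YO' nXY' eXY'.
  have [Z [ZO s1 s2]] := om_elimination oO XO' YO' nXY' eXY'.
  have [wZ wX' wY'] := And3 (om_wf oO ZO) (om_wf oO XO') (om_wf oO YO').
  exists Z; split=> // [|h].
    by apply/negP; rewrite inE => /orP[/(subsetP s1)|/(subsetP s2)]; rewrite !inE eqxx.
  rewrite inE => /orP[hZ|hZ].
    have /eqP -> : signed_vector Z h == 1%R by rewrite sv_pos.
    by have := subsetP s1 _ hZ; rewrite !inE -!sv_pos => /andP[_ /orP[]/eqP ->]; auto.
  have /eqP -> : signed_vector Z h == (-1)%R by rewrite sv_neg.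
  have := subsetP s2 _ hZ; rewrite !inE -!sv_neg // => /andP[_ /orP[]/eqP ->]; auto.
case: (sv_supp eX) => eX1; rewrite eX1 in eXY.
  by apply: key; rewrite // inE -sv_pos -sv_neg // eX1 -[signed_vector Y e]opprK -eXY !eqxx.
have nYX : Y <> sopp X by move=> eYX; apply: nXY; rewrite eYX soppK.
have eYX : e \in Y.1 :&: X.2.
  by rewrite inE -sv_pos -sv_neg // eX1 -[signed_vector Y e]opprK -eXY !eqxx.
have [Z [ZO eZ hZ]] := key Y X YO XO nYX eYX; exists Z; split=> // h /hZ[]; auto.
Qed.

Lemma om_supp O X Y : oriented_matroid O -> X \in scircuits O -> Y \in scircuits O ->
  supp X \subset supp Y -> supp X = supp Y.
Proof.
by move=> oO XO YO /(om_incomparable oO XO YO)[] ->; rewrite ?supp_opp.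
Qed.

Lemma elimination_supp O X Y e : oriented_matroid O ->
    X \in scircuits O -> Y \in scircuits O -> supp X != supp Y ->
    e \in supp X -> e \in supp Y ->
  exists2 Z, Z \in scircuits O & supp Z \subset (supp X :|: supp Y) :\ e.
Proof.
move=> oO XO YO nXY eX eY.
have key Y' : Y' \in scircuits O -> supp Y' = supp Y ->
    signed_vector X e = (- signed_vector Y' e)%R ->
    exists2 Z, Z \in scircuits O & supp Z \subset (supp X :|: supp Y) :\ e.
  move=> YO' sY' eXY.
  have [|Z [ZO eZ hZ]] := elimination oO XO YO' _ eX eXY.
    by move=> eXY'; rewrite eXY' supp_opp sY' eqxx in nXY.
  exists Z => //; apply/subsetP => h hh; rewrite in_setD1 in_setU; apply/andP; split.
    by apply: contraNneq eZ => <-.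
  rewrite -sY'; have := hh; rewrite -[_ \in supp Z]sv_neq0.
  by case: (hZ h hh) => ->; rewrite sv_neq0 => ->; rewrite ?orbT.
have wY := om_wf oO YO.
case: (eqVneq (signed_vector X e) (- signed_vector Y e)%R) => [|ne]; first exact: key.
apply: (key (sopp Y)); rewrite ?supp_opp ?(om_symmetric oO) // sv_opp // opprK.
by case: (sv_supp eX) (sv_supp eY) ne => -> [] ->; rewrite ?opprK ?eqxx.
Qed.

End Signs.

Section Flows.
Variables (T : finType) (O : signed_system T).

Lemma flow_circuit X : X \in scircuits O -> is_flow O (signed_vector X).
Proof.
move=> XO; exists (fun Y => (Y == X)%:R%R).
rewrite (bigD1 X) //= eqxx mulr1z big1 ?addr0 // => Y /andP[_ /negPf ->].
by rewrite mulr0z.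
Qed.

Lemma flow_combine (f g : {ffun T -> int}) (c : int) :
  is_flow O f -> is_flow O g -> is_flow O (f + g *~ c)%R.
Proof.
move=> [a ->] [b ->]; exists (fun X => a X + b X * c)%R.
rewrite mulrz_suml -big_split /=; apply: eq_bigr => X _.
by rewrite mulrzDr mulrzA.
Qed.

Lemma combineE (f g : {ffun T -> int}) (c : int) h :
  (f + g *~ c)%R h = (f h + c * g h)%R.
Proof.
rewrite ffunE; congr (_ + _)%R; rewrite mulrC -mulrzz.
case: c => n; first by rewrite -!pmulrn ffunMnE.
by rewrite !NegzE !mulrNz -!pmulrn ffunE ffunMnE.
Qed.

End Flows.

(** * Circuits inside a set of nullity two *)

Section NullityTwo.
Variables (T : finType) (O : signed_system T) (F : {set T}).
Hypothesis oO : oriented_matroid O.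
Implicit Types (A B W Z : signed_set T).
Local Notation sv := signed_vector.
Let circ Z := Z \in scircuits O /\ supp Z \subset F.
(** Nullity at most two, in terms of circuits: deleting an element of [F] leaves at most one circuit
    up to sign. *)
Hypothesis unique_miss : forall Z W g, circ Z -> circ W ->
  g \in F -> g \notin supp Z -> g \notin supp W -> supp Z = supp W.

Let cover A B h : circ A -> circ B -> supp A != supp B -> h \in F ->
  h \notin supp A -> h \in supp B.
Proof.
move=> cA cB nAB hF hA; apply: contraNT nAB => hB.
by rewrite (unique_miss cA cB hF hA hB).
Qed.

Let elim_circ A B g : circ A -> circ B -> supp A != supp B ->
    g \in supp A -> sv A g = (- sv B g)%R ->
  exists Z, [/\ circ Z, g \notin supp Z &
    forall h, h \in supp Z -> sv Z h = sv A h \/ sv Z h = sv B h].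
Proof.
move=> [AO AF] [BO BF] nAB gA gAB.
have [|Z [ZO gZ hZ]] := elimination oO AO BO _ gA gAB.
  by move=> eAB; rewrite eAB supp_opp eqxx in nAB.
exists Z; split=> //; split=> //; apply/subsetP => h hh.
by case: (hZ h hh) => eh; [apply: (subsetP AF)|apply: (subsetP BF)];
  rewrite -sv_neq0 -eh sv_neq0.
Qed.

Let circ_neg A : circ A -> circ (sopp A).
Proof. by move=> [AO AF]; split; rewrite ?supp_opp // om_symmetric. Qed.

Let same_or_opp A B : circ A -> circ B -> supp A = supp B -> A = B \/ A = sopp B.
Proof. by move=> [AO _] [BO _] sAB; apply: (om_incomparable oO); rewrite // sAB. Qed.

Let circ_wf A : circ A -> wf A.
Proof. by case=> AO _; apply: om_wf AO. Qed.

(** If [A] and [B] agreed at [h] and disagreed at [g], both outside [Z], then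
    eliminating [g] from [A, B] and [h] from [A, -B] would both give [Z] up to
    sign, with equal signs on [F \ B] and opposite signs on [F \ A]. *)
Let consistent A B Z : circ A -> circ B -> circ Z ->
    supp A != supp B -> supp A != supp Z -> supp B != supp Z ->
  exists c : int, (c = 1 \/ c = -1)%R /\
    forall h, h \notin supp Z -> (sv A h = c * sv B h)%R.
Proof.
move=> cA cB cZ nAB nAZ nBZ; have [AF BF] := (proj2 cA, proj2 cB).
have sg h : h \notin supp Z -> (h \in F /\ (sv A h = sv B h \/ sv A h = (- sv B h)%R))
      \/ (sv A h = 0 /\ sv B h = 0)%R.
  move=> hZ; case: (boolP (h \in F)) => hF; [left|right].
    have hA : h \in supp A by apply: cover hZ; rewrite // eq_sym.
    have hB : h \in supp B by apply: cover hZ; rewrite // eq_sym.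
    by split=> //; case: (sv_supp hA) (sv_supp hB) => -> [] ->; rewrite ?opprK; auto.
  have [hA hB] : h \notin supp A /\ h \notin supp B.
    by split; apply: contra hF; apply/subsetP.
  by rewrite (sv_eq0 hA) (sv_eq0 hB).
have [/forallP allE|] :=
    boolP [forall h, (h \notin supp Z) ==> (sv A h == sv B h)].
  exists 1%R; split=> [|h hZ]; first by left.
  by have /implyP/(_ hZ)/eqP := allE h; rewrite mul1r.
rewrite negb_forall => /existsP[g]; rewrite negb_imply => /andP[gZ gAB].
have [/forallP allN|] :=
    boolP [forall h, (h \notin supp Z) ==> (sv A h == - sv B h)%R].
  exists (-1)%R; split=> [|h hZ]; first by right.
  by have /implyP/(_ hZ)/eqP := allN h; rewrite mulN1r.
rewrite negb_forall => /existsP[h]; rewrite negb_imply => /andP[hZ hAB]; exfalso.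
have [gF gN] : g \in F /\ sv A g = (- sv B g)%R.
  by case: (sg g gZ) => [[? []]|[e1 e2]] //; [move=> e1|]; rewrite e1 ?e2 eqxx in gAB.
have [hF hE] : h \in F /\ sv A h = sv B h.
  by case: (sg h hZ) => [[? []]|[e1 e2]] //; [move=> e1|]; rewrite e1 ?e2 ?oppr0 eqxx in hAB.
have gA : g \in supp A by apply: cover gZ; rewrite // eq_sym.
have hA : h \in supp A by apply: cover hZ; rewrite // eq_sym.
have [V [cV gV VAB]] := elim_circ cA cB nAB gA gN.
have [W [cW hW WAB]] : exists W, [/\ circ W, h \notin supp W &
    forall k, k \in supp W -> sv W k = sv A k \/ sv W k = sv (sopp B) k].
  apply: elim_circ => //; rewrite ?supp_opp //; first exact: circ_neg.
  by rewrite sv_opp ?opprK //; apply: circ_wf.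
have sV : supp V = supp Z by apply: unique_miss gV gZ.
have sW : supp W = supp Z by apply: unique_miss hW hZ.
have [x xF xB] : exists2 x, x \in F & x \notin supp B.
  have /subsetPn[x xA xB] : ~~ (supp A \subset supp B).
    by apply: contra nAB => /(om_supp oO (proj1 cA) (proj1 cB)) ->.
  by exists x => //; apply: (subsetP AF).
have [y yF yA] : exists2 y, y \in F & y \notin supp A.
  have /subsetPn[y yB yA] : ~~ (supp B \subset supp A).
    by apply: contra nAB => /(om_supp oO (proj1 cB) (proj1 cA)) ->.
  by exists y => //; apply: (subsetP BF).
have xZ : x \in supp Z by apply: cover xB.
have yZ : y \in supp Z by apply: cover yA.
have [wB wV wW] := And3 (circ_wf cB) (circ_wf cV) (circ_wf cW).
have xV : sv V x = sv A x.
  case: (VAB x) => //; rewrite ?sV // (sv_eq0 xB) => /eqP.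
  by rewrite -[_ == _]negbK sv_neq0 sV xZ.
have xW : sv W x = sv A x.
  case: (WAB x) => //; rewrite ?sW // sv_opp // (sv_eq0 xB) oppr0 => /eqP.
  by rewrite -[_ == _]negbK sv_neq0 sW xZ.
have yV : sv V y = sv B y.
  case: (VAB y) => //; rewrite ?sV // (sv_eq0 yA) => /eqP.
  by rewrite -[_ == _]negbK sv_neq0 sV yZ.
have yW : sv W y = (- sv B y)%R.
  case: (WAB y); rewrite ?sW // ?sv_opp // (sv_eq0 yA) => /eqP.
  by rewrite -[_ == _]negbK sv_neq0 sW yZ.
have x0 : sv A x != 0%R by rewrite -xV sv_neq0 sV.
have y0 : sv B y != 0%R by rewrite -yV sv_neq0 sV.
have [eVW|eVW] : V = W \/ V = sopp W by apply: same_or_opp; rewrite // sV sW.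
  by move/eqP: yV; rewrite eVW yW eqNr (negPf y0).
by move/eqP: xV; rewrite eVW sv_opp // xW eqNr (negPf x0).
Qed.

(** Induction on the number of elements where [A] and [B] have opposite signs. With none, [A - B]
    already vanishes on the intersection. Otherwise eliminating such a [g] gives a circuit [Z] with
    fewer disagreements with [A] and with [B], and the flows for [A, Z] and for [Z, B] are
    combined. *)
Lemma difference_flow A B : circ A -> circ B -> supp A != supp B ->
  exists (w : {ffun T -> int}) (a b : int),
    [/\ is_flow O w, (a = 1 \/ a = -1)%R, (b = 1 \/ b = -1)%R &
     forall h, w h = ((if h \in supp B then 0 else a * sv A h) +
                      (if h \in supp A then 0 else b * sv B h))%R].
Proof.
have [m] := ubnP #|[set h | sv A h * sv B h == -1]%R|.
elim: m A B => // m IH A B mAB cA cB nAB.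
have [/set0Pn[g]|] := boolP ([set h | sv A h * sv B h == -1]%R != set0); last first.
  rewrite negbK => /eqP D0.
  exists (sv A + sv B *~ (-1))%R, 1%R, (-1)%R; split; auto.
    by apply: flow_combine; apply: flow_circuit; [case: cA|case: cB].
  move=> h; have : h \notin [set h | sv A h * sv B h == -1]%R by rewrite D0 inE.
  rewrite combineE in_set.
  case: ifPn => hB; case: ifPn => hA; rewrite ?(sv_eq0 hA) ?(sv_eq0 hB).
  - by case: (sv_supp hA) (sv_supp hB) => -> [->|->].
  - by [].
  - by rewrite mulr0 mul1r.
  - by rewrite !mulr0.
rewrite in_set => gAB.
have {gAB} [gA gN] : g \in supp A /\ sv A g = (- sv B g)%R.
  rewrite -sv_neq0; have := sv_values A g; have := sv_values B g; rewrite !inE.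
  by move=> /or3P[]/eqP e1 /or3P[]/eqP e2; move: gAB; rewrite e1 e2.
have [Z [cZ gZ ZAB]] := elim_circ cA cB nAB gA gN.
have gB : g \in supp B by rewrite -sv_neq0 -oppr_eq0 -gN sv_neq0.
have nAZ : supp A != supp Z by apply: contraNneq gZ => <-.
have nZB : supp Z != supp B by apply: contraNneq gZ => ->.
have nBZ : supp B != supp Z by rewrite eq_sym.
have nZA : supp Z != supp A by rewrite eq_sym.
have nBA : supp B != supp A by rewrite eq_sym.
have gD : g \in [set h | sv A h * sv B h == -1]%R.
  by rewrite inE gN; case: (sv_supp gB) => ->.
have lt1 : #|[set h | sv A h * sv Z h == -1]%R| < m.
  rewrite -ltnS; apply: leq_trans mAB; rewrite ltnS; apply: proper_card.
  apply/properP; split.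
    apply/subsetP => h; rewrite !inE => /eqP hAZ; apply/eqP.
    have hZ : h \in supp Z by rewrite -sv_neq0; apply: contra_eqN hAZ => /eqP ->; rewrite mulr0.
    case: (ZAB h hZ) => e1; last by rewrite -e1.
    by move: hAZ; rewrite -e1; case: (sv_supp hZ) => ->.
  by exists g => //; rewrite inE (sv_eq0 gZ) mulr0.
have lt2 : #|[set h | sv Z h * sv B h == -1]%R| < m.
  rewrite -ltnS; apply: leq_trans mAB; rewrite ltnS; apply: proper_card.
  apply/properP; split.
    apply/subsetP => h; rewrite !inE => /eqP hAZ; apply/eqP.
    have hZ : h \in supp Z by rewrite -sv_neq0; apply: contra_eqN hAZ => /eqP ->; rewrite mul0r.
    case: (ZAB h hZ) => e1; first by rewrite -e1.
    by move: hAZ; rewrite -e1; case: (sv_supp hZ) => ->.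
  by exists g => //; rewrite inE (sv_eq0 gZ) mul0r.
have [u [a1 [b1 [fu a1P b1P hu]]]] := IH A Z lt1 cA cZ nAZ.
have [w [a2 [b2 [fw a2P b2P hw]]]] := IH Z B lt2 cZ cB nZB.
have [c [cP hc]] := consistent cA cB cZ nAB nAZ nBZ.
have [d [dP hd]] := consistent cZ cB cA nZB nZA nBA.
have [k [kP hk]] := consistent cZ cA cB nZA nZB nAB.
(* Outside [Z] one has [u = a1 * A], [w = b2 * B] and [A = c * B], so this multiple of [u] cancels
   [w]. Off [B] and off [A], the constants [k] and [d] convert values of [Z] into values of [A] and
   of [B]. *)
exists (w + u *~ (- (a1 * b2 * c)))%R, (a2 * k)%R, (- (a1 * b2 * c * b1 * d))%R.
split.
- exact: flow_combine.
- by case: a2P kP => -> [] ->; rewrite ?mulN1r ?mul1r ?opprK; auto.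
- by case: a1P b2P cP b1P dP => -> [] -> [] -> [] -> [] ->;
    rewrite ?mulN1r ?mul1r ?opprK; auto.
move=> h; rewrite combineE.
rewrite hu hw; case: (boolP (h \in F)) => hF; last first.
  have /negP hA : h \notin supp A by apply: contra hF; apply/subsetP/(proj2 cA).
  have /negP hB : h \notin supp B by apply: contra hF; apply/subsetP/(proj2 cB).
  have /negP hZ : h \notin supp Z by apply: contra hF; apply/subsetP/(proj2 cZ).
  move: hA hB hZ => /negP hA /negP hB /negP hZ.
  by rewrite !sv_eq0 //; do !case: ifP => _; ring.
case: (boolP (h \in supp Z)) => hZ; last first.
  rewrite (cover cZ cA _ hF hZ) // (cover cZ cB _ hF hZ) // (hc h hZ).
  by case: a1P b2P cP => -> [] -> [] ->; ring.
case: (boolP (h \in supp A)) => hA; last first.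
  rewrite (cover cA cB _ hF hA) // (hd h hA).
  by ring.
case: (boolP (h \in supp B)) => hB; first by ring.
by rewrite (hk h hB); ring.
Qed.

End NullityTwo.

(** The flow of [difference_flow] vanishes where the two supports meet, so only [e] and [f] remain,
    each with value 1 or -1. *)
Lemma exchange_flow (T : finType) (O : signed_system T) X Y e f :
    oriented_matroid O -> X \in scircuits O -> Y \in scircuits O ->
    supp X :\: supp Y = [set e] -> supp Y :\: supp X = [set f] ->
  exists w : {ffun T -> int},
    [/\ is_flow O w, sign_valued w, w <> 0%R & #|[set h | w h != 0%R]| <= 2].
Proof.
move=> oO XO YO XY YX.
have [eX eY] : e \in supp X /\ e \notin supp Y.
  by apply/andP; rewrite andbC -in_setD XY inE.
have [fY fX] : f \in supp Y /\ f \notin supp X.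
  by apply/andP; rewrite andbC -in_setD YX inE.
set F := supp X :|: supp Y.
have Fe h : h \in F -> h \notin supp Y -> h = e.
  move=> hF hY; apply/eqP; rewrite -in_set1 -XY inE hY.
  by move: hF; rewrite inE (negPf hY) orbF.
have Ff h : h \in F -> h \notin supp X -> h = f.
  move=> hF hX; apply/eqP; rewrite -in_set1 -YX inE hX.
  by move: hF; rewrite inE (negPf hX).
have in_X Z : Z \in scircuits O -> supp Z \subset F -> f \notin supp Z ->
    supp Z = supp X.
  move=> ZO ZF fZ; apply: (om_supp oO) => //; apply/subsetP => h hZ.
  by apply: contraNT fZ => /(Ff h (subsetP ZF _ hZ)) <-.
(* A circuit in [F] without [f] has the support of [X]. If different [Z] and [W] both contain [f]
   and miss [g], eliminating [f] yields this support, which then misses [g]; so [g] is [f], a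
   contradiction. *)
have um Z W g : Z \in scircuits O /\ supp Z \subset F ->
    W \in scircuits O /\ supp W \subset F ->
    g \in F -> g \notin supp Z -> g \notin supp W -> supp Z = supp W.
  move=> [ZO ZF] [WO WF] gF gZ gW; apply/eqP/negPn/negP => nZW.
  have [fZ|fZ] := boolP (f \in supp Z); last first.
    have eZ := in_X Z ZO ZF fZ.
    have gf : g = f by apply: Ff; rewrite // -eZ.
    by rewrite eZ (in_X W) ?eqxx // -gf in nZW.
  have [fW|fW] := boolP (f \in supp W); last first.
    have eW := in_X W WO WF fW.
    have gf : g = f by apply: Ff; rewrite // -eW.
    by rewrite gf fZ in gZ.
  have [V VO sV] := elimination_supp oO ZO WO nZW fZ fW.
  have VF : supp V \subset F.
    apply: subset_trans sV _; apply: subset_trans (subsetDl _ _) _.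
    by rewrite subUset ZF.
  have fV : f \notin supp V by apply/negP => /(subsetP sV); rewrite !inE eqxx.
  have eV := in_X V VO VF fV.
  have gV : g \notin supp V.
    by apply/negP => /(subsetP sV); rewrite in_setD1 in_setU (negPf gZ) (negPf gW) andbF.
  have gf : g = f by apply: Ff; rewrite // -eV.
  by rewrite gf fZ in gZ.
have nXY : supp X != supp Y by apply: contraNneq eY => <-.
have [w [a [b [fw aP bP hw]]]] := difference_flow oO um
  (conj XO (subsetUl _ _)) (conj YO (subsetUr _ _)) nXY.
have w0 h : h != e -> h != f -> w h = 0%R.
  move=> he hf; rewrite hw; case: ifPn => hY; case: ifPn => hX; rewrite ?addr0 ?add0r //.
  - by case/eqP: hf; apply: Ff; rewrite // inE hY orbT.
  - by case/eqP: he; apply: Fe; rewrite // inE hX.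
  by rewrite !sv_eq0 // !mulr0 addr0.
have we : (w e = 1 \/ w e = -1)%R.
  rewrite hw eX (negPf eY) addr0.
  by case: aP (sv_supp eX) => -> [] ->; rewrite ?mulN1r ?mul1r ?opprK; auto.
have wf' : (w f = 1 \/ w f = -1)%R.
  rewrite hw fY (negPf fX) add0r.
  by case: bP (sv_supp fY) => -> [] ->; rewrite ?mulN1r ?mul1r ?opprK; auto.
exists w; split=> //.
- move=> h; rewrite !inE; have [->|he] := eqVneq h e; first by case: we => ->.
  have [->|hf] := eqVneq h f; first by case: wf' => ->.
  by rewrite w0.
- by move=> w00; case: we; rewrite w00 ffunE.
apply: leq_trans (subset_leq_card _) (_ : #|[set e; f]| <= 2).
  apply/subsetP => h; rewrite !inE; apply: contraR; rewrite negb_or => /andP[he hf].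
  by rewrite w0.
by rewrite cards2; case: (_ != _).
Qed.

(** * Contraction of oriented matroids *)

(** For subsets of the ground set, this is independence in [underlying O]. *)
Definition circuit_free (T : finType) (O : signed_system T) (I : {set T}) :=
  [forall X in scircuits O, ~~ (supp X \subset I)].

Lemma circuit_freeN (T : finType) (O : signed_system T) I X :
  circuit_free O I -> X \in scircuits O -> supp X \subset I -> False.
Proof. by move=> /forall_inP fI /fI /negP. Qed.

Section Contraction.
Variables (T : finType) (O : signed_system T) (A : {set T}).
Hypothesis oO : oriented_matroid O.
Implicit Types (X Y Z V W D : signed_set T) (I K : {set T}).
Local Notation sv := signed_vector.

Lemma contractP X' : reflect
  ((exists2 X, X \in scircuits O & X' = sdiff X A /\ supp (sdiff X A) != set0) /\
   forall W, W \in scircuits O -> supp (sdiff W A) != set0 ->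
     supp (sdiff W A) \subset supp X' -> supp (sdiff W A) = supp X')
  (X' \in scircuits (contract O A)).
Proof.
rewrite in_set; apply: (iffP andP) => [[/imsetP[X]]|[[X XO [-> X0]] minX]].
  rewrite in_set => /andP[XO X0] -> /forall_inP minX; split; first by exists X.
  move=> W WO W0 sW; apply/eqP.
  have /minX /implyP : sdiff W A \in
      [set sdiff Z A | Z in scircuits O & supp (sdiff Z A) != set0].
    by apply/imsetP; exists W; rewrite // in_set WO.
  exact.
split; first by apply/imsetP; exists X; rewrite // in_set XO.
apply/forall_inP => Z /imsetP[W]; rewrite in_set => /andP[WO W0] ->.
by apply/implyP => sW; rewrite (minX W).
Qed.

(** A circuit with empty restriction would lie in [A], hence in the independent set [I]. *)
Lemma restriction_neq0 I Z : circuit_free O I -> Z \in scircuits O ->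
  supp Z \subset ~: A :|: I -> supp (sdiff Z A) != set0.
Proof.
move=> fI ZO sZ; rewrite supp_diff; apply: contraPneq (circuit_freeN fI ZO) => Z0.
move=> /(_ _)[]; apply/subsetP => h hZ.
have := subsetP sZ h hZ; rewrite in_setU in_setC => /orP[hA|//].
by have := in_set0 h; rewrite -Z0 in_setD hA hZ.
Qed.

Lemma contract_below W : W \in scircuits O -> supp (sdiff W A) != set0 ->
  exists V, [/\ V \in scircuits O, sdiff V A \in scircuits (contract O A) &
                supp (sdiff V A) \subset supp (sdiff W A)].
Proof.
have [m] := ubnP #|supp (sdiff W A)|; elim: m W => // m IH W Wm WO W0.
have [cW|] := boolP (sdiff W A \in scircuits (contract O A)); first by exists W.
rewrite in_set => /nandP[|].
  by case/imsetP; exists W; rewrite // in_set WO.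
case/forall_inPn => Z /imsetP[V]; rewrite in_set => /andP[VO V0] ->.
rewrite negb_imply => /andP[sVW nVW].
have [|U [UO cU sU]] := IH V _ VO V0.
  by rewrite -ltnS; apply: leq_trans Wm; rewrite ltnS proper_card // properEneq nVW.
by exists U; split=> //; apply: subset_trans sVW.
Qed.

(** A basis of [A]. Contracting [I0] turns the rest of [A] into loops, so circuits of the
    contraction lift to circuits inside [~: A :|: I0], where no restriction is empty. *)
Variable I0 : {set T}.
Hypothesis sI0 : I0 \subset A.
Hypothesis fI0 : circuit_free O I0.
Hypothesis maxI0 : forall a, a \in A -> a \notin I0 ->
  exists2 D, D \in scircuits O & supp D \subset a |: I0.

(** If [X] meets [A] outside [I0], exchange such an element [a] of an
    independent set [I] with [X \cap A \subset I] for some [b] in [I0], and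
    eliminate [a] between [X] and the fundamental circuit of [b] in [I]. *)
Lemma contract_lift X : X \in scircuits O -> sdiff X A \in scircuits (contract O A) ->
  exists Y, [/\ Y \in scircuits O, sdiff Y A = sdiff X A & supp Y \subset ~: A :|: I0].
Proof.
have [m] := ubnP #|(supp X :&: A) :\: I0|; elim: m X => // m IH X Xm XO cX.
have [_ minX] := contractP _ cX.
have X0 : supp (sdiff X A) != set0 by case: (contractP _ cX) => [[W _ [-> ->]]].
set K := supp X :&: A.
have nXA : ~~ (supp X \subset A).
  move: X0; rewrite supp_diff; apply: contraNN => sXA.
  by rewrite setD_eq0.
have [KI0|] := boolP (K \subset I0).
  exists X; split=> //; apply/subsetP => h hX; rewrite in_setU in_setC.
  by case: (boolP (h \in A)) => //= hA; apply: (subsetP KI0); rewrite in_setI hX.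
case/subsetPn => a0 a0K a0I.
have fK : circuit_free O K.
  apply/forall_inP => W WO; apply: contra nXA => sWK.
  have sWX : supp W \subset supp X by apply: subset_trans sWK (subsetIl _ _).
  by rewrite -(om_supp oO WO XO sWX); apply: subset_trans sWK (subsetIr _ _).
pose P I := circuit_free O I && (I \subset K :|: I0).
have PK : P K by rewrite /P fK subsetUl.
have [I /maxsetP[/andP[fI sI] maxI] KI] := maxset_exists PK.
have sIA : I \subset A.
  by apply: subset_trans sI _; rewrite subUset sI0 subsetIr.
have [b bI0 bI] : exists2 b, b \in I0 & b \notin I.
  apply/subsetPn/negP => I0I.
  have a0A : a0 \in A by move: a0K; rewrite in_setI => /andP[].
  have [D DO sD] := maxI0 a0A a0I; apply: (circuit_freeN fI DO).
  by apply: subset_trans sD _; rewrite subUset sub1set (subsetP KI).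
have [D DO sD] : exists2 D, D \in scircuits O & supp D \subset b |: I.
  have /nandP[] : ~~ P (b |: I).
    by apply: contraNN bI => /maxI <-; rewrite ?setU11 ?subsetUr.
  - by case/forall_inPn => D DO; rewrite negbK; exists D.
  - by case/negP; rewrite subUset sub1set in_setU bI0 orbT.
have bD : b \in supp D.
  apply/negPn/negP => bD; apply: (circuit_freeN fI DO); apply/subsetP => h hD.
  by case/setU1P: (subsetP sD h hD) => // hb; rewrite -hb hD in bD.
have [a aD aI0] : exists2 a, a \in supp D & a \notin I0.
  by apply/subsetPn/negP; exact: (circuit_freeN fI0 DO).
have ab : a != b by apply: contraNneq aI0 => ->.
have aI : a \in I by case/setU1P: (subsetP sD a aD) => // /eqP; rewrite (negPf ab).
have aK : a \in K.
  by move: (subsetP sI a aI); rewrite in_setU (negPf aI0) orbF.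
have /setIP[aX aA] := aK.
pose I' := b |: (I :\ a).
have fI' : circuit_free O I'.
  apply/forall_inP => W WO; apply/negP => sW.
  have bW : b \in supp W.
    apply/negPn/negP => bW; apply: (circuit_freeN fI WO); apply/subsetP => h hW.
    case/setU1P: (subsetP sW h hW) => [hb|]; first by rewrite -hb hW in bW.
    by case/setD1P.
  have aW : a \notin supp W.
    by apply/negP => /(subsetP sW); rewrite in_setU1 in_setD1 eqxx (negPf ab).
  have nWD : supp W != supp D by apply: contraNneq aW => ->.
  have [V VO sV] := elimination_supp oO WO DO nWD bW bD.
  apply: (circuit_freeN fI VO); apply/subsetP => h /(subsetP sV) /setD1P[hb].
  case/setUP => [/(subsetP sW)|/(subsetP sD)]; case/setU1P; rewrite ?(eqP hb) //;
    by [move=> e; rewrite e eqxx in hb | case/setD1P].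
have [D' [DO' sD' aXD]] : exists D', [/\ D' \in scircuits O, supp D' = supp D &
    sv X a = (- sv D' a)%R].
  have wD := om_wf oO DO.
  case: (eqVneq (sv X a) (- sv D a)%R) => ne; first by exists D.
  exists (sopp D); rewrite supp_opp om_symmetric // sv_opp // opprK; split=> //.
  by case: (sv_supp aX) (sv_supp aD) ne => -> [] ->; rewrite ?opprK ?eqxx.
have DA h : h \notin A -> sv D' h = 0%R.
  move=> hA; apply: sv_eq0; rewrite sD'; apply: contra hA => /(subsetP sD).
  by case/setU1P => [->|hI]; [apply: (subsetP sI0)|apply: (subsetP sIA)].
have nXD : X <> sopp D'.
  move=> e; move: nXA; rewrite e supp_opp sD'; case/negP.
  by apply: subset_trans sD _; rewrite subUset sub1set (subsetP sI0).
have [Y [YO aY hY]] := elimination oO XO DO' nXD aX aXD.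
have YX h : h \in supp Y -> h \notin A -> sv Y h = sv X h.
  move=> hhY hA; case: (hY h hhY) => //; rewrite DA // => /eqP.
  by rewrite -[_ == _]negbK sv_neq0 hhY.
have YI h : h \in supp Y -> h \in A -> h \in I'.
  move=> hhY hA; have ha : h != a by apply: contraNneq aY => <-.
  rewrite in_setU1 in_setD1 ha /=.
  have [e|e] := hY h hhY.
    by rewrite (subsetP KI) ?orbT // in_setI hA -sv_neq0 -e sv_neq0 hhY.
  have : h \in supp D by rewrite -sD' -sv_neq0 -e sv_neq0.
  by move/(subsetP sD); rewrite in_setU1.
have Y0 : supp (sdiff Y A) != set0.
  apply: (restriction_neq0 fI') => //; apply/subsetP => h hhY.
  by rewrite in_setU in_setC; case: (boolP (h \in A)) => // /(YI h hhY).
have sYX : supp (sdiff Y A) = supp (sdiff X A).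
  apply: minX => //; apply/subsetP => h; rewrite !supp_diff => /setDP[hhY hA].
  by rewrite in_setD hA -sv_neq0 -YX // sv_neq0.
have eYX : sdiff Y A = sdiff X A.
  apply: sv_inj; try by apply: wf_diff; apply: om_wf oO _.
  move=> h; rewrite !sv_diff; case: ifPn => // hA.
  case: (boolP (h \in supp Y)) => hhY; first exact: YX.
  have hX : h \notin supp X.
    apply: contra hhY => hX.
    have : h \in supp (sdiff Y A) by rewrite sYX supp_diff in_setD hA.
    by rewrite supp_diff => /setDP[].
  by rewrite !sv_eq0.
rewrite -eYX in cX *; apply: IH => //.
rewrite -ltnS; apply: leq_trans Xm; rewrite ltnS; apply: proper_card.
apply/properP; split.
  apply/subsetP => h /setDP[/setIP[hhY hA] hI0].
  rewrite in_setD hI0 /=; case/setU1P: (YI h hhY hA) => [e|/setD1P[_ hI]].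
    by rewrite e bI0 in hI0.
  by move: (subsetP sI h hI); rewrite in_setU (negPf hI0) orbF.
exists a; first by rewrite in_setD aI0.
by rewrite in_setD in_setI (negPf aY) andbF.
Qed.

Let local Z := Z \in scircuits O /\ supp Z \subset ~: A :|: I0.

Let local_elim X Y h : local X -> local Y -> supp X != supp Y ->
    h \in supp X -> sv X h = (- sv Y h)%R ->
  exists Z, [/\ local Z, h \notin supp Z &
    forall k, k \in supp Z -> sv Z k = sv X k \/ sv Z k = sv Y k].
Proof.
move=> [XO sX] [YO sY] nXY hX hXY.
have [|Z [ZO hZ ZXY]] := elimination oO XO YO _ hX hXY.
  by move=> e; rewrite e supp_opp eqxx in nXY.
exists Z; split=> //; split=> //; apply/subsetP => k kZ.
by case: (ZXY k kZ) => e; [apply: (subsetP sX)|apply: (subsetP sY)];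
  rewrite -sv_neq0 -e sv_neq0.
Qed.

(** Eliminating between [W] and [Z] an element off [A] where their signs are opposite loses this
    element, keeps the restriction inside that of [Z] and creates no new opposition. Iterating
    removes all oppositions. *)
Let conformal_step Z W : local Z -> local W ->
    supp (sdiff W A) \proper supp (sdiff Z A) ->
  exists V, [/\ local V, supp (sdiff V A) \proper supp (sdiff Z A) &
    forall h, h \notin A -> h \in supp V -> sv V h = sv Z h].
Proof.
have [m] := ubnP #|[set h in ~: A | sv W h == - sv Z h]%R :&: supp W|.
elim: m W => // m IH W Wm lZ lW pWZ.
have [|] := boolP ([set h in ~: A | sv W h == - sv Z h]%R :&: supp W == set0).
  move/eqP => D0; exists W; split=> // h hA hW.
  have hZ : h \in supp Z.
    by have := subsetP (proper_sub pWZ) h; rewrite !supp_diff !in_setD hA; apply.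
  have := in_set0 h; rewrite -D0 in_setI hW in_set in_setC hA /= andbT.
  by case: (sv_supp hZ) (sv_supp hW) => -> [] ->.
case/set0Pn => h; rewrite in_setI in_set in_setC => /andP[/andP[hA /eqP hWZ] hW].
have nWZ : supp W != supp Z.
  by apply: contraTneq pWZ => e; rewrite !supp_diff e properxx.
have [V [lV hV VWZ]] := local_elim lW lZ nWZ hW hWZ.
have sVZ k : k \notin A -> k \in supp V -> k \in supp Z.
  move=> kA kV; case: (VWZ k kV) => e; last by rewrite -sv_neq0 -e sv_neq0.
  have := subsetP (proper_sub pWZ) k; rewrite !supp_diff !in_setD kA; apply.
  by rewrite -sv_neq0 -e sv_neq0.
apply: (IH V) => //.
  rewrite -ltnS; apply: leq_trans Wm; rewrite ltnS; apply: proper_card.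
  apply/properP; split; last first.
    exists h; first by rewrite in_setI in_set in_setC hA hWZ eqxx.
    by rewrite in_setI (negPf hV) andbF.
  apply/subsetP => k; rewrite in_setI in_set in_setC => /andP[/andP[kA /eqP kVZ] kV].
  rewrite in_setI in_set in_setC kA /=.
  case: (VWZ k kV) => e; first by rewrite -e kVZ eqxx -sv_neq0 -e sv_neq0.
  by move: kVZ; rewrite -e; case: (sv_supp kV) => ->.
apply/properP; split.
  by apply/subsetP => k; rewrite !supp_diff => /setDP[kV kA]; rewrite in_setD kA sVZ.
exists h; last by rewrite supp_diff in_setD (negPf hV) andbF.
have := subsetP (proper_sub pWZ) h; rewrite !supp_diff !in_setD hA; exact.
Qed.

(** Repeated [conformal_step] shrinks the restriction of [Z] without changing signs until it is
    minimal. *)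
Lemma conformal_circuit Z : Z \in scircuits O -> supp Z \subset ~: A :|: I0 ->
  exists V, [/\ V \in scircuits O, sdiff V A \in scircuits (contract O A) &
    forall h, h \notin A -> h \in supp V -> sv V h = sv Z h].
Proof.
have [m] := ubnP #|supp (sdiff Z A)|; elim: m Z => // m IH Z Zm ZO sZ.
have [W0 [WO cW sW]] := contract_below ZO (restriction_neq0 fI0 ZO sZ).
have [W [{}WO eW lW]] := contract_lift WO cW; rewrite -eW in cW sW.
have [e|ne] := eqVneq (supp (sdiff W A)) (supp (sdiff Z A)).
  exists Z; split=> //; apply/contractP; split.
    by exists Z; rewrite // (restriction_neq0 fI0).
  by move=> U UO U0; rewrite -e; apply: (proj2 (contractP _ cW)).
have [|V [[VO sV] pV hV]] := @conformal_step Z W (conj ZO sZ) (conj WO lW).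
  by rewrite properEneq ne.
have [|U [UO cU hU]] := IH V _ VO sV.
  by rewrite -ltnS; apply: leq_trans Zm; rewrite ltnS proper_card.
exists U; split=> // h hA hhU; rewrite hU // hV //.
by rewrite -sv_neq0 -hU // sv_neq0.
Qed.

Lemma contract_oriented_with_basis : oriented_matroid (contract O A).
Proof.
have lift X' : X' \in scircuits (contract O A) ->
    exists X, [/\ local X, wf X & X' = sdiff X A].
  move=> cX; have [[X XO [eX _]] _] := contractP _ cX; rewrite eX in cX *.
  have [Y [YO eY sY]] := contract_lift XO cX.
  by exists Y; split=> //; apply: om_wf YO.
split.
- by move=> X' /lift[X [_ wX ->]]; apply: wf_diff.
- by move=> X' /lift[X [[XO _] wX ->]]; rewrite supp_diff setSD // (om_ground oO).
- by move=> X' cX; have [[X XO [-> ->]]] := contractP _ cX.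
- move=> X' cX; have [[X XO [eX X0]] minX] := contractP _ cX.
  apply/contractP; split; last by rewrite supp_opp.
  by exists (sopp X); rewrite ?om_symmetric // eX -sopp_diff supp_opp.
- move=> X' Y' cX cY sXY.
  have [X [[XO sX] wX eX]] := lift X' cX; have [Y [[YO sY] wY eY]] := lift Y' cY.
  have [_ minX] := contractP _ cX; have [_ minY] := contractP _ cY.
  have X0 : supp (sdiff X A) != set0 by apply: (restriction_neq0 fI0).
  have sXYe : supp X' = supp Y' by rewrite eX minY -?eX // eX.
  case: (eqVneq (supp X) (supp Y)) => [e|ne].
    have /(om_incomparable oO XO YO)[] : supp X \subset supp Y by rewrite e.
      by rewrite eX eY => ->; left.
    by rewrite eX eY => ->; right; rewrite sopp_diff.
  have [h hX'] := set0Pn _ X0.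
  have /setDP[hX hA] : h \in supp X :\: A by rewrite -supp_diff.
  have /setDP[hY _] : h \in supp Y :\: A by rewrite -supp_diff -eY -sXYe eX.
  (* Were the lifted supports different, eliminating [h] would give a nonempty restriction strictly
     inside the minimal one. *)
  have [V VO sV] := elimination_supp oO XO YO ne hX hY.
  have V0 : supp (sdiff V A) != set0.
    apply: (restriction_neq0 fI0) => //; apply: subset_trans sV _.
    by apply: subset_trans (subsetDl _ _) _; rewrite subUset sX.
  have sVX : supp (sdiff V A) \subset supp X'.
    apply/subsetP => k; rewrite supp_diff => /setDP[/(subsetP sV)/setD1P[_ kXY] kA].
    case/setUP: kXY => kk; first by rewrite eX supp_diff in_setD kA.
    by rewrite sXYe eY supp_diff in_setD kA.
  have : h \in supp X' by rewrite eX.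
  rewrite -(minX V VO V0 sVX) supp_diff => /setDP[/(subsetP sV)].
  by rewrite in_setD1 eqxx.
move=> X' Y' e cX cY nXY eXY.
have [X [[XO sX] wX eX]] := lift X' cX; have [Y [[YO sY] wY eY]] := lift Y' cY.
move: eXY; rewrite eX eY /sdiff /= => /setIP[/setDP[e1 eA] /setDP[e2 _]].
have nXY' : X <> sopp Y by move=> e'; apply: nXY; rewrite eX eY e' sopp_diff.
have eXin : e \in supp X by rewrite in_setU e1.
have eXYs : sv X e = (- sv Y e)%R.
  by move: e1 e2; rewrite -sv_pos -sv_neg // => /eqP -> /eqP ->; rewrite opprK.
(* Eliminate between the lifts in [O]. The restriction of [Z] need not be minimal, so a conformal
   circuit below it is taken. *)
have [Z [ZO eZ ZXY]] := elimination oO XO YO nXY' eXin eXYs.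
have sZ : supp Z \subset ~: A :|: I0.
  apply/subsetP => k kZ; case: (ZXY k kZ) => ek.
    by apply: (subsetP sX); rewrite -sv_neq0 -ek sv_neq0.
  by apply: (subsetP sY); rewrite -sv_neq0 -ek sv_neq0.
have [V [VO cV hV]] := conformal_circuit ZO sZ.
have wV := om_wf oO VO.
have key k : k \in supp V -> k \notin A ->
    k != e /\ (sv V k = sv X k \/ sv V k = sv Y k).
  move=> kV kA; have kZ : k \in supp Z by rewrite -sv_neq0 -hV // sv_neq0.
  by split; [apply: contraNneq eZ => <-|rewrite hV //; apply: ZXY].
exists (sdiff V A); split=> //; apply/subsetP => k /setDP[kV kA].
  have [|ke eq] := key k _ kA; first by rewrite in_setU kV.
  rewrite in_setD1 ke in_setU !in_setD kA /= -!sv_pos.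
  by move: kV; rewrite -sv_pos => /eqP e0; case: eq => <-; rewrite e0 ?orbT.
have [|ke eq] := key k _ kA; first by rewrite in_setU kV orbT.
rewrite in_setD1 ke in_setU !in_setD kA /= -!sv_neg //.
by move: kV; rewrite -sv_neg // => /eqP e0; case: eq => <-; rewrite e0 ?orbT.
Qed.

(** The restriction of a circuit inside [J :|: I0] contains a circuit of the contraction, by
    [conformal_circuit]; conversely [contract_lift] puts a circuit inside [J] back into
    [J :|: I0]. *)
Lemma contract_free (J : {set T}) : [disjoint J & A] ->
  circuit_free (contract O A) J = circuit_free O (J :|: I0).
Proof.
move=> dJ; apply/forall_inP/forall_inP => fJ.
  move=> Z ZO; apply/negP => sZ.
  have sZ' : supp Z \subset ~: A :|: I0.
    by apply: subset_trans sZ _; rewrite setSU // -disjoints_subset.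
  have [V [VO cV hV]] := conformal_circuit ZO sZ'.
  have /negP[] := fJ _ cV; apply/subsetP => h; rewrite supp_diff => /setDP[hhV hA].
  have hZ : h \in supp Z by rewrite -sv_neq0 -hV // sv_neq0.
  case/setUP: (subsetP sZ h hZ) => // /(subsetP sI0); by rewrite (negPf hA).
move=> X' cX; have [[X XO [eX _]] _] := contractP _ cX; rewrite eX in cX *.
have [Y [YO eY sY]] := contract_lift XO cX; rewrite -eY; apply: contra (fJ Y YO).
move=> /subsetP sYJ; apply/subsetP => h hY; rewrite in_setU.
case: (boolP (h \in A)) => hA; last by rewrite sYJ // supp_diff in_setD hA.
by move: (subsetP sY h hY); rewrite in_setU in_setC hA /= => ->; rewrite orbT.
Qed.

End Contraction.

Lemma circuit_free_basis (T : finType) (O : signed_system T) (A : {set T}) :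
    oriented_matroid O ->
  exists I0 : {set T}, [/\ I0 \subset A, circuit_free O I0 & forall a, a \in A -> a \notin I0 ->
    exists2 D, D \in scircuits O & supp D \subset a |: I0].
Proof.
move=> oO; pose P (I : {set T}) := circuit_free O I && (I \subset A).
have P0 : P set0.
  rewrite /P sub0set andbT; apply/forall_inP => X XO.
  by rewrite subset0 (om_nonempty oO).
have [I /maxsetP[/andP[fI sI] maxI] _] := maxset_exists P0.
exists I; split=> // a aA aI.
have /nandP[] : ~~ P (a |: I).
  by apply: contraNN aI => /maxI <-; rewrite ?setU11 ?subsetUr.
- by case/forall_inPn => D DO; rewrite negbK; exists D.
- by case/negP; rewrite subUset sub1set aA.
Qed.

Lemma contract_oriented (T : finType) (O : signed_system T) (A : {set T}) :
  oriented_matroid O -> oriented_matroid (contract O A).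
Proof.
move=> oO; have [I0 [sI0 fI0 maxI0]] := circuit_free_basis A oO.
exact: contract_oriented_with_basis sI0 fI0 maxI0.
Qed.

Lemma delete_oriented (T : finType) (O : signed_system T) (A : {set T}) :
  oriented_matroid O -> oriented_matroid (delete O A).
Proof.
move=> oO; have inO X : X \in scircuits (delete O A) -> X \in scircuits O.
  by rewrite in_set => /andP[].
split.
- by move=> X /inO; apply: om_signed.
- by move=> X; rewrite in_set => /andP[].
- by move=> X /inO; apply: om_nonempty.
- by move=> X; rewrite !in_set supp_opp => /andP[/(om_symmetric oO) ->].
- by move=> X Y /inO XO /inO YO; apply: (om_incomparable oO).
move=> X Y e XO YO nXY eXY.
have [Z [ZO Z1 Z2]] := om_elimination oO (inO _ XO) (inO _ YO) nXY eXY.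
exists Z; split=> //; rewrite in_set ZO.
move: XO YO; rewrite !in_set => /andP[_ sX] /andP[_ sY].
apply/subsetP => h; rewrite in_setU => /orP[/(subsetP Z1)|/(subsetP Z2)] /setD1P[_];
  case/setUP => hh; [apply: (subsetP sX)|apply: (subsetP sY)
    |apply: (subsetP sX)|apply: (subsetP sY)]; by rewrite in_setU hh ?orbT.
Qed.

(** * Hall's condition *)

Section Hall.
Variables (T V : finType).
Implicit Types (n : T -> {set V}) (J K L R : {set T}) (v w : V).

Definition nbr n K := \bigcup_(e in K) n e.

(** By Hall's theorem, the existence of distinct representatives for the sets [n e] with [e] in [J]:
    independence in a transversal matroid. *)
Definition hall n J := [forall K : {set T}, (K \subset J) ==> (#|K| <= #|nbr n K|)].

Lemma hallP n J : reflect (forall K, K \subset J -> #|K| <= #|nbr n K|) (hall n J).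
Proof. by apply: (iffP forallP) => H K; apply/implyP; apply: H. Qed.

Lemma nbrP n K v : reflect (exists2 e, e \in K & v \in n e) (v \in nbr n K).
Proof. exact: bigcupP. Qed.

Lemma nbrS n J K : J \subset K -> nbr n J \subset nbr n K.
Proof.
move=> sJK; apply/subsetP => v /nbrP[e eJ ve].
by apply/nbrP; exists e; rewrite ?(subsetP sJK).
Qed.

Lemma nbrU n J K : nbr n (J :|: K) = nbr n J :|: nbr n K.
Proof. exact: bigcup_setU. Qed.

Lemma nbr1 n e : nbr n [set e] = n e.
Proof. exact: big_set1. Qed.

Lemma nbrU1 n e K : nbr n (e |: K) = n e :|: nbr n K.
Proof. by rewrite nbrU nbr1. Qed.

Lemma sub_nbr n e K : e \in K -> n e \subset nbr n K.
Proof. by move=> eK; apply: bigcup_sup eK. Qed.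

(** A Hall family with members of size at most two contracts to another one:
    to contract [a] with [n a = {u, v}], identify [u] with [v]; if [n a = {u}],
    erase [u]. *)
Lemma hall_contract1 n a : (forall e, #|n e| <= 2) -> n a != set0 ->
  exists n' : T -> {set V}, (forall e, #|n' e| <= 2) /\
    forall J, a \notin J -> hall n (a |: J) = hall n' J.
Proof.
move=> n2 /set0Pn[u ua]; pose D := n a :\ u.
have D1 : #|D| <= 1 by move: (n2 a); rewrite (cardsD1 u) ua.
have uD : u \notin D by rewrite in_setD1 eqxx.
pose n' e := if u \in n e then (n e :\ u) :|: D else n e.
have nbrE K : nbr n' K = if u \in nbr n K then (nbr n K :\ u) :|: D else nbr n K.
  apply/setP => v; apply/nbrP/idP => [[e eK]|].
    rewrite /n'; have sub := subsetP (sub_nbr n eK).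
    case: ifP => ue; first rewrite (sub _ ue) !in_setU !in_setD1.
      by case/orP=> [/andP[-> /sub ->]|->]; rewrite ?orbT.
    move=> ve; case: ifP => _; last exact: sub.
    by rewrite in_setU in_setD1 sub // andbT; case: eqP => // e'; rewrite -e' ve in ue.
  case: ifP => [/nbrP[e eK ue]|/negbT uK].
    case/setUP => [/setD1P[vu /nbrP[f fK vf]]|vD].
      exists f => //; rewrite /n'; case: ifP => // _.
      by rewrite in_setU in_setD1 vu vf.
    by exists e; rewrite // /n' ue in_setU vD orbT.
  case/nbrP => f fK vf; exists f => //; rewrite /n'; case: ifP => // uf.
  by case/negP: uK; apply/nbrP; exists f.
exists n'; split=> [e|J aJ].
  rewrite /n'; case: ifP => // ue; apply: leq_trans (leq_card_setU _ _) _.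
  by move: (n2 e); rewrite (cardsD1 u) ue; lia.
apply/hallP/hallP => hJ K sK.
  rewrite nbrE; case: ifPn => uK; last by apply: hJ; apply: subset_trans sK (subsetUr _ _).
  have := hJ (a |: K) (setUS _ sK).
  rewrite cardsU1 (contraNN (subsetP sK a) aJ) nbrU1 (cardsD1 u) in_setU ua /= ltnS.
  move/leq_trans; apply; apply: subset_leq_card; apply/subsetP => v.
  rewrite in_setD1 in_setU => /andP[vu /orP[va|vK]].
    by apply/setUP; right; rewrite in_setD1 vu.
  by rewrite in_setU in_setD1 vu vK.
have [aK|aK] := boolP (a \in K); last first.
  have sKJ : K \subset J.
    apply/subsetP => e eK; case/setU1P: (subsetP sK e eK) => // ea.
    by rewrite -ea eK in aK.
  apply: leq_trans (hJ K sKJ) _; rewrite nbrE; case: ifPn => // uK.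
  by apply: leq_trans (leq_card_setU _ _) _; rewrite [X in _ <= X](cardsD1 u) uK; lia.
have sKJ : K :\ a \subset J by rewrite subDset.
rewrite (cardsD1 a) aK -{2}(setD1K aK) nbrU1 add1n.
apply: leq_ltn_trans (hJ _ sKJ) _.
apply: proper_card; apply/properP; split; last first.
  exists u; first by rewrite in_setU ua.
  by rewrite nbrE; case: ifPn => //; rewrite in_setU (negPf uD) orbF in_setD1 eqxx.
rewrite nbrE; case: ifPn => _; last exact: subsetUr.
apply/subsetP => v; rewrite !in_setU !in_setD1.
by case/orP => /andP[_ ->]; rewrite ?orbT.
Qed.

(** The elements of [I] are contracted one at a time; Hall's condition passes to the remaining ones,
    so each still has a nonempty set when its turn comes. *)
Lemma hall_contract n I : (forall e, #|n e| <= 2) -> hall n I ->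
  exists n' : T -> {set V}, (forall e, #|n' e| <= 2) /\
    forall J, [disjoint J & I] -> hall n (J :|: I) = hall n' J.
Proof.
have [m] := ubnP #|I|; elim: m n I => // m IH n I Im n2 hI.
have [->|/set0Pn[a aI]] := eqVneq I set0.
  by exists n; split=> // J _; rewrite setU0.
have na : n a != set0.
  rewrite -card_gt0 -nbr1 -(cards1 a).
  by apply: (hallP _ _ hI); rewrite sub1set.
have [n1 [n12 hn1]] := hall_contract1 n2 na.
have aI' : a \notin I :\ a by rewrite setD11.
have [||n' [n'2 hn']] := IH n1 (I :\ a) _ n12.
- by move: Im; rewrite (cardsD1 a) aI.
- by rewrite -hn1 // setD1K.
exists n'; split=> // J dJ; rewrite -hn'; last first.
  by apply: disjointWr dJ; apply: subD1set.
rewrite -hn1; last by rewrite in_setU negb_or aI' (disjointFl dJ aI).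
by rewrite setUCA setD1K.
Qed.

(** The circuits of the transversal matroid. *)
Definition hall_circuit n K :=
  #|nbr n K| < #|K| /\ forall L, L \proper K -> #|L| <= #|nbr n L|.

Lemma hall_circuit_exists n J : ~~ hall n J -> exists2 K, hall_circuit n K & K \subset J.
Proof.
rewrite negb_forall => /existsP[L]; rewrite negb_imply -ltnNge => /andP[sLJ ltL].
have [K /minsetP[ltK minK] sKL] := @minset_exists _ (fun K => #|nbr n K| < #|K|) _ ltL.
exists K; last exact: subset_trans sLJ.
split=> // K' /properP[sK' [x xK xK']]; rewrite leqNgt; apply/negP => lt'.
by case/negP: xK'; rewrite (minK _ lt' sK').
Qed.

(** A cycle described by counts alone, since contraction replaces the end sets of edges by an
    abstract family. *)
Definition hall_cycle n C :=
  [/\ #|nbr n C| = #|C|, C != set0 &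
      forall L, L \proper C -> L != set0 -> #|L| < #|nbr n L|].

Lemma hall_cycle_hall n C : hall_cycle n C -> hall n C.
Proof.
move=> [eC _ hC]; apply/hallP => K; rewrite subEproper => /orP[/eqP ->|pK].
  by rewrite eC.
have [->|K0] := eqVneq K set0; first by rewrite cards0.
exact/ltnW/hC.
Qed.

(** The strict surplus of each proper nonempty part of [C] pays for [b]; only [C] as a whole
    cannot. *)
Lemma chord_circuit n C b : hall_cycle n C -> b \notin C -> n b != set0 ->
  n b \subset nbr n C -> hall_circuit n (b |: C).
Proof.
move=> cC bC b0 sb; have [eC C0 hC] := cC; split.
  by rewrite nbrU1 (setUidPr sb) eC cardsU1 bC.
move=> L pL; have [bL|bL] := boolP (b \in L); last first.
  apply: (hallP _ _ (hall_cycle_hall cC)); apply/subsetP => e eL.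
  case/setU1P: (subsetP (proper_sub pL) e eL) => // eb.
  by rewrite -eb eL in bL.
have pLC : L :\ b \proper C.
  rewrite properEneq subDset (proper_sub pL) andbT.
  by apply: contraTneq pL => <-; rewrite setD1K // properxx.
rewrite (cardsD1 b) bL add1n.
have [L0|L0] := eqVneq (L :\ b) set0.
  rewrite L0 cards0 card_gt0; apply: contraNneq b0 => nL.
  by rewrite -subset0 -nL sub_nbr.
apply: leq_trans (hC _ pLC L0) _.
by apply: subset_leq_card; apply: nbrS; apply: subD1set.
Qed.

(** Circuits through [w] of the family obtained by erasing [w]. *)
Definition rooted_circuit n w L :=
  [/\ #|nbr n L :\ w| < #|L|, (forall K, K \proper L -> #|K| <= #|nbr n K :\ w|) &
      w \in nbr n L].

(** Erasing [w] costs at most one vertex: proper parts can afford it, the whole cycle cannot. *)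
Lemma hall_cycle_rooted n C w : hall_cycle n C -> w \in nbr n C -> rooted_circuit n w C.
Proof.
move=> [eC _ hC] wC; split=> // [|K pK].
  by rewrite -eC [X in _ < X](cardsD1 w) wC.
have [->|K0] := eqVneq K set0; first by rewrite cards0.
by have := hC K pK K0; rewrite (cardsD1 w); case: (_ \in _) => //=; lia.
Qed.

(** Each side lacks one vertex once [w] is erased. The union lacks two and [w] restores only one; a
    proper part is complete on at most one side, and [w] restores what is missing there. *)
Lemma rooted_circuit_glue n w L R : rooted_circuit n w L -> rooted_circuit n w R ->
  nbr n L :&: nbr n R \subset [set w] -> [disjoint L & R] -> hall_circuit n (L :|: R).
Proof.
move=> [ltL hL wL] [ltR hR wR] sw dLR.
have cardLR : #|L :|: R| = #|L| + #|R|.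
  by apply/eqP; rewrite -(leq_card_setU L R) in dLR *.
split.
  rewrite nbrU (cardsD1 w) in_setU wL setDUl cardLR /=.
  by have := leq_of_leqif (leq_card_setU (nbr n L :\ w) (nbr n R :\ w)); lia.
move=> K pK; have eK : K = (K :&: L) :|: (K :&: R).
  by rewrite -setIUr; apply/esym/setIidPl/proper_sub.
have card_split (A B : {set T}) : A \subset L -> B \subset R ->
    #|nbr n A :\ w| + #|nbr n B :\ w| + (w \in nbr n (A :|: B)) = #|nbr n (A :|: B)|.
  move=> sA sB; rewrite [in RHS](cardsD1 w) nbrU setDUl addnC; congr (_ + _).
  apply/esym/eqP; rewrite (leq_card_setU (nbr n A :\ w) _).
  rewrite -setI_eq0; apply/eqP/setP => v; rewrite in_setI !in_setD1 in_set0.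
  apply/negP => /andP[/andP[vw vA] /andP[_ vB]].
  have : v \in nbr n L :&: nbr n R.
    by rewrite in_setI (subsetP (nbrS n sA)) // (subsetP (nbrS n sB)).
  by move/(subsetP sw); rewrite in_set1 (negPf vw).
(* Deleting one element of [C] shows that [C] itself lacks at most one vertex. *)
have low (C A : {set T}) : rooted_circuit n w C -> A \subset C ->
    #|A| <= #|nbr n A :\ w| + (A == C).
  move=> [ltC hC wC]; rewrite subEproper => /orP[/eqP ->|pA]; last first.
    by rewrite (leq_trans (hC A pA)) ?leq_addr.
  rewrite eqxx addn1; have /card_gt0P[x xC] : 0 < #|C| by apply: leq_trans ltC.
  have pC : C :\ x \proper C by apply: properD1.
  rewrite (cardsD1 x) xC add1n ltnS; apply: leq_trans (hC _ pC) _.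
  by apply: subset_leq_card; apply: setSD; apply: nbrS; apply: subD1set.
have cardK : #|K| = #|K :&: L| + #|K :&: R|.
  rewrite {1}eK; apply/eqP; rewrite (leq_card_setU (K :&: L) _).
  by apply: disjointWl (subsetIr _ _) _; apply: disjointWr (subsetIr _ _) dLR.
have rL : rooted_circuit n w L by []. have rR : rooted_circuit n w R by [].
have lowL := low _ _ rL (subsetIr K L); have lowR := low _ _ rR (subsetIr K R).
have := card_split _ _ (subsetIr K L) (subsetIr K R); rewrite -eK cardK => <-.
have wK A : w \in nbr n A -> K :&: A = A -> w \in nbr n K.
  by move=> wA eA; apply: (subsetP (nbrS n (subsetIl K A))); rewrite eA.
case: (eqVneq (K :&: L) L) lowL => eL lowL; case: (eqVneq (K :&: R) R) lowR => eR lowR;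
  rewrite /= in lowL lowR.
- by case/negP: (proper_neq pK); rewrite eK eL eR.
- by rewrite (wK L) //=; lia.
- by rewrite (wK R) //=; lia.
- by lia.
Qed.

End Hall.

(** * Circuits exchanging one element *)

(** [A] may be infinite and [P] undecidable: the bound turns the maximum into a least value of
    [b - m a], reached by excluded middle. *)
Lemma exists_maximal (A : Type) (P : A -> Prop) (m : A -> nat) (b : nat) :
  (exists a, P a) -> (forall a, P a -> m a <= b) ->
  exists2 a, P a & forall a', P a' -> m a' <= m a.
Proof.
move=> exP bm.
have [[k]|nobound] := classic (exists k, exists2 a, P a & b - m a < k); last first.
  by case: exP => a Pa; case: nobound; exists (b - m a).+1, a.
elim: k => [[a _]|k IH [a Pa lt]]; first by rewrite ltn0.
have [|none] := classic (exists2 a', P a' & b - m a' < k); first exact: IH.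
exists a => // a' Pa'; rewrite leqNgt; apply/negP => lt'; apply: none.
by exists a' => //; have := bm a' Pa'; lia.
Qed.

(** * Cycles given by a cyclic sequence of vertices *)

Section VertexCycles.
Variables (T V : finType) (n : T -> {set V}) (c : seq V) (phi : V -> T).
Hypotheses (uc : uniq c) (c0 : c != [::]).
Hypothesis phi_inj : {in c &, injective phi}.
Hypothesis phiE : forall x, x \in c -> n (phi x) = [set x; next c x].

Lemma nbr_vertex_cycle : nbr n [set phi x | x in c] = [set x in c].
Proof.
apply/setP => v; rewrite inE; apply/nbrP/idP => [[_ /imsetP[x xc ->]]|vc].
  by rewrite phiE // in_set2 => /orP[]/eqP -> //; rewrite mem_next.
by exists (phi v); [apply: imset_f|rewrite phiE // set21].
Qed.

(** A part [L] corresponds to the set [X] of its tails, which lies in its neighbourhood. Without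
    further neighbours [X] would be closed under [next c], hence the whole cycle. *)
Lemma vertex_cycle : hall_cycle n [set phi x | x in c].
Proof.
split.
- by rewrite nbr_vertex_cycle cardsE card_in_imset.
- by case: c c0 => // x s _; apply/set0Pn; exists (phi x); rewrite imset_f // mem_head.
move=> L pL L0; pose X := [set x in c | phi x \in L].
have Xc x : x \in X -> x \in c by rewrite inE => /andP[].
have eL : L = [set phi x | x in X].
  apply/setP => e; apply/idP/imsetP => [eL|[x]]; last by rewrite inE => /andP[_ ?] ->.
  case/imsetP: (subsetP (proper_sub pL) e eL) => x xc ex.
  by exists x; rewrite // inE xc -ex.
rewrite {1}eL card_in_imset; last by move=> x y /Xc xc /Xc yc; apply: phi_inj.
apply: proper_card; apply/properP; split.
  apply/subsetP => x; rewrite inE => /andP[xc xL]; apply/nbrP.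
  by exists (phi x); rewrite // phiE // set21.
apply/subsetPn/negP => sX.
have clX x : x \in X -> next c x \in X.
  rewrite inE => /andP[xc xL]; apply: (subsetP sX); apply/nbrP.
  by exists (phi x); rewrite // phiE // set22.
case/set0Pn: L0 => e; rewrite eL => /imsetP[x xX _].
case/properP: pL => _ [f /imsetP[y yc ->]] /negP[].
have yx : fconnect (next c) x y by rewrite (fconnect_cycle (cycle_next uc) (Xc x xX)).
rewrite eL imset_f // -(iter_findex yx); elim: (findex _ _ _) => //= k IH.
exact: clX.
Qed.

End VertexCycles.

(** * Exchange pairs in cosimple Hall families *)

Section Exchange.
Variables (T V : finType) (n : T -> {set V}) (E : {set T}).
Hypothesis n2 : forall e, #|n e| <= 2.
(** Cosimplicity in terms of bases: any two elements, possibly equal, are avoided by a common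
    basis. *)
Hypothesis cosimpleE : forall e f, e \in E -> f \in E ->
  exists B : {set T}, [/\ B \subset E, hall n B, e \notin B, f \notin B &
    forall g, g \in E -> hall n (g |: B) -> g \in B].
(** A circuit with at most two elements gives the desired flow by itself, so that case is set
    aside. *)
Hypothesis no_small : forall K : {set T}, K \subset E -> #|K| <= 2 -> #|K| <= #|nbr n K|.
Implicit Types (C K L R : {set T}) (v w x y : V) (e f g : T).

Definition exchange_pair := exists C1 C2 : {set T}, exists e f,
  [/\ C1 \subset E /\ C2 \subset E, hall_circuit n C1, hall_circuit n C2,
      C1 :\: C2 = [set e] & C2 :\: C1 = [set f]].

Let star v := [set e in E | v \in n e].

(** If two elements covered the star of [v], a basis avoiding them would miss [v], and [e] could be
    added to it with [v] as a new vertex. *)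
Lemma star_gt2 v : v \in nbr n E -> 2 < #|star v|.
Proof.
move=> /nbrP[e eE ve]; rewrite ltnNge; apply/negP => s2.
have es : e \in star v by rewrite inE eE.
have [f fE sef] : exists2 f, f \in E & star v \subset [set e; f].
  have [s0|/set0Pn[f fs]] := eqVneq (star v :\ e) set0.
    by exists e => //; rewrite -(setD1K es) s0 setU0 subsetUl.
  exists f; first by move: fs; rewrite !inE => /andP[_ /andP[]].
  rewrite -(setD1K es) setUS //; apply/subsetP => g gs; rewrite inE.
  apply: contraLR s2 => gf; rewrite -ltnNge (cardsD1 e) es (cardsD1 f) fs.
  by rewrite (cardsD1 g) in_setD1 gf gs.
have [B [BE hB eB fB maxB]] := cosimpleE eE fE.
have Bv g : g \in B -> v \notin n g.
  move=> gB; apply/negP => vg.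
  have : g \in star v by rewrite inE (subsetP BE).
  by move/(subsetP sef); rewrite in_set2 => /orP[]/eqP eg; rewrite -eg gB in eB fB.
case/negP: (eB); apply: maxB => //; apply/hallP => K sK.
have sKB : K :\ e \subset B by rewrite subDset.
have [eK|eK] := boolP (e \in K); last first.
  by apply: (hallP _ _ hB); apply: subset_trans sKB; rewrite subsetD1 subxx.
rewrite (cardsD1 e) eK add1n; apply: leq_ltn_trans (hallP _ _ hB _ sKB) _.
apply: proper_card; apply/properP; split; first by apply/nbrS/subD1set.
exists v; first by apply/nbrP; exists e.
by apply/nbrP => -[g /(subsetP sKB) /Bv /negP].
Qed.

(** A piece [H] attached to the rest at [w] only: a maximal Hall set [B] avoiding
    [e] and [f] provides a rooted circuit [R] outside [H] that closes [L1]
    and [L2] up to circuits. *)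
Lemma end_exchange (H L1 L2 : {set T}) w e f e1 e2 :
    H \subset E -> e \in H -> f \in H -> e != f -> hall n (H :\ f) ->
    (forall g, g \in E -> g \notin H -> n g :&: nbr n H \subset [set w]) ->
    rooted_circuit n w L1 -> rooted_circuit n w L2 ->
    L1 \subset H -> L2 \subset H ->
    L1 :\: L2 = [set e1] -> L2 :\: L1 = [set e2] ->
  exchange_pair.
Proof.
move=> HE eH fH ef hH att r1 r2 s1 s2 d12 d21.
have [B [BE hB eB fB maxB]] := cosimpleE (subsetP HE e eH) (subsetP HE f fH).
have attS R : R \subset B -> R :&: H = set0 -> nbr n H :&: nbr n R \subset [set w].
  move=> RB RH; apply/subsetP => v; rewrite in_setI => /andP[vH /nbrP[g gR vg]].
  have gH : g \notin H by apply/negP => gH; have := in_set0 g; rewrite -RH inE gR gH.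
  by apply: (subsetP (att g (subsetP BE _ (subsetP RB _ gR)) gH)); rewrite inE vg vH.
have [R [RB RH rR]] : exists R, [/\ R \subset B, R :&: H = set0 & rooted_circuit n w R].
  have /existsP[K] : ~~ hall n (e |: B) by apply: contra eB => /maxB; apply; apply: (subsetP HE).
  rewrite negb_imply -ltnNge => /andP[sK ltK].
  have sH : K :&: H \subset H :\ f.
    apply/subsetP => g; rewrite !inE => /andP[/(subsetP sK)/setU1P gK gH].
    rewrite gH andbT; case: gK => [->|gB] //; apply: contraNneq fB => <- //.
  have sR : K :\: H \subset B.
    apply/subsetP => g; rewrite !inE => /andP[gH /(subsetP sK)/setU1P[ge|//]].
    by rewrite ge eH in gH.
  have KHH : (K :\: H) :&: H = set0.
    by rewrite setDE -setIA [~: H :&: H]setIC setICr setI0.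
  (* The part of [K] in [H] avoids [f], so it satisfies Hall's condition, and it shares at most [w]
     with the rest. Hence the deficiency of [K] survives outside [H] once [w] is erased. *)
  have lt : #|nbr n (K :\: H) :\ w| < #|K :\: H|.
    have dis : [disjoint nbr n (K :&: H) & nbr n (K :\: H) :\ w].
      rewrite -setI_eq0; apply/eqP/setP => v; rewrite in_setI in_setD1 in_set0.
      apply/negP => /andP[vH /andP[vw vR]].
      have : v \in nbr n H :&: nbr n (K :\: H).
        by rewrite in_setI vR (subsetP (nbrS n (subsetIr K H))).
      by move/(subsetP (attS _ sR KHH)); rewrite in_set1 (negPf vw).
    have lowH := hallP _ _ hH _ sH.
    have le : #|nbr n (K :&: H)| + #|nbr n (K :\: H) :\ w| <= #|nbr n K|.
      move: dis; rewrite -(leq_card_setU (nbr n (K :&: H)) _) => /eqP <-.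
      apply: subset_leq_card; rewrite subUset nbrS ?subsetIl //=.
      by apply: subset_trans (subD1set _ _) (nbrS _ (subsetDl _ _)).
    rewrite -(ltn_add2l #|nbr n (K :&: H)|); apply: leq_ltn_trans le _.
    by apply: leq_trans ltK _; rewrite -(cardsID H K) leq_add2r.
  have [R /minsetP[ltR minR] sRK] := @minset_exists _ (fun R => #|nbr n R :\ w| < #|R|) _ lt.
  have RB := subset_trans sRK sR.
  exists R; split=> //.
    apply/eqP; rewrite setI_eq0; apply: disjointWl sRK _.
    by rewrite -setI_eq0 KHH.
  split=> // [K' pK'|].
    rewrite leqNgt; apply/negP => lt'; case/properP: pK' => sK' [g gR] /negP[].
    by rewrite (minR _ lt' sK').
  (* [R] lies in the Hall set [B], so only the erasure of [w] can make it deficient. *)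
  apply/negPn/negP => wR; have := hallP _ _ hB R RB.
  by rewrite (cardsD1 w) (negPf wR) leqNgt ltR.
have glue L : L \subset H -> rooted_circuit n w L -> hall_circuit n (L :|: R).
  move=> LH rL; apply: (rooted_circuit_glue rL rR).
    by apply: subset_trans (attS R RB RH); apply: setSI; apply: nbrS.
  by apply: disjointWl LH _; rewrite disjoint_sym -setI_eq0 RH.
have RE := subset_trans RB BE.
have diff L L' : L \subset H -> (L :|: R) :\: (L' :|: R) = L :\: L'.
  move=> LH; apply/setP => g; rewrite !inE.
  case: (boolP (g \in R)) => gR; rewrite ?orbT ?orbF //=.
  have -> : g \in L = false; last by rewrite andbF.
  by apply/negP => /(subsetP LH) gH; have := in_set0 g; rewrite -RH inE gR gH.
exists (L1 :|: R), (L2 :|: R), e1, e2; split; rewrite ?diff //; try exact: glue.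
by rewrite !subUset RE !andbT; split; [apply: subset_trans s1 HE|apply: subset_trans s2 HE].
Qed.

Let adj x y := (x != y) && [exists e in E, n e == [set x; y]].

Let adj_sym x y : adj x y = adj y x.
Proof. by rewrite /adj eq_sym setUC. Qed.

Let n_neq0 e : e \in E -> n e != set0.
Proof.
move=> eE; rewrite -card_gt0 -nbr1; apply: leq_trans (no_small _ _); rewrite ?cards1 //.
by rewrite sub1set.
Qed.

Let link_or_loop e x : e \in E -> x \in n e ->
  n e = [set x] \/ exists2 y, adj x y & n e = [set x; y].
Proof.
move=> eE xe; have [n0|/set0Pn[y ye]] := eqVneq (n e :\ x) set0; [left|right].
  by rewrite -(setD1K xe) n0 setU0.
have eq : n e = [set x; y].
  apply/esym/eqP; rewrite eqEcard subUset !sub1set xe /=.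
  move: ye; rewrite in_setD1 => /andP[yx ->] /=.
  by apply: leq_trans (n2 e) _; rewrite cards2 eq_sym yx.
exists y => //; apply/andP; split; first by move: ye; rewrite in_setD1 eq_sym => /andP[].
by apply/existsP; exists e; rewrite eE eq eqxx.
Qed.

Let one_loop e f x : e \in E -> f \in E -> e != f -> n e = [set x] -> n f = [set x] -> False.
Proof.
move=> eE fE ef ne nf; have := no_small (K := [set e; f]).
rewrite subUset !sub1set eE fE nbrU !nbr1 ne nf setUid cards1 cards2 ef.
by move=> /(_ isT isT).
Qed.

Let adj_nbr x y : adj x y -> x \in nbr n E.
Proof.
case/andP=> _ /existsP[e /andP[eE /eqP ne]]; apply/nbrP; exists e => //.
by rewrite ne set21.
Qed.

(** At least three elements meet [x] and, by [one_loop], at most one of them is a loop. *)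
Let has_adj x : x \in nbr n E -> exists y, adj x y.
Proof.
move/star_gt2/card_gt2P => [e [f [g [[]]]]]; rewrite !inE.
move=> /andP[eE xe] /andP[fE xf] _ [ef _ _].
case: (link_or_loop eE xe) => [ne|[y xy _]]; last by exists y.
case: (link_or_loop fE xf) => [nf|[y xy _]]; last by exists y.
by case: (one_loop eE fE ef ne nf).
Qed.

(** The part [q] closes up with [u] to a cycle, or to a single link when [q] has one vertex; [p] is
    the tail of the path beyond [u]. *)
Let lasso (a : seq V * V * seq V) := let: (q, u, p) := a in
  [/\ q != [::], uniq (q ++ u :: p), sorted adj (q ++ u :: p) & adj (head u q) u].

Let total (a : seq V * V * seq V) := size a.1.1 + size a.2.

(** A longest path, with the first end adjacent to a vertex as far as possible
    along the path. *)
Let extremal a := [/\ lasso a, forall a', lasso a' -> total a' <= total a &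
  forall a', lasso a' -> total a' = total a -> size a.2 <= size a'.2].

Let extremal_exists : E != set0 -> exists a, extremal a.
Proof.
case/set0Pn => e eE; have /set0Pn[x xe] := n_neq0 eE.
have xE : x \in nbr n E by apply/nbrP; exists e.
have [y xy] := has_adj xE.
have ex1 : exists a, lasso a.
  exists ([:: x], y, [::]); split=> //=; rewrite ?xy // inE andbT.
  by case/andP: xy.
have bd a : lasso a -> total a <= #|V|.
  case: a => [[q u] p] [_ uq _ _]; rewrite /total /=.
  have := max_card (mem (q ++ u :: p)); rewrite (card_uniqP uq) size_cat /=; lia.
have [a la maxa] := exists_maximal ex1 bd.
(* Maximizing [#|V| - size b.2] makes the tail shortest, that is, the cycle longest. *)
have [b [lb tb] minb] := @exists_maximal _ (fun b => lasso b /\ total b = total a)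
  (fun b => #|V| - size b.2) #|V| (ex_intro _ a (conj la erefl)) (fun b _ => leq_subr _ _).
exists b; split=> // [a' la'|a' la' ta']; first by rewrite tb maxa.
have := minb a' (conj la' (etrans ta' tb)).
by have := bd b lb; have := bd a' la'; rewrite /total; lia.
Qed.

(** [q'] reorders [q] into another longest path, with first end [x]. A neighbour of [x] off the path
    would lengthen it; one on the tail [p] would give a lasso of the same length with a shorter
    tail. *)
Let first_end q u p q' x : extremal (q, u, p) -> perm_eq q' q ->
    sorted adj (q' ++ u :: p) -> head u q' = x ->
  forall e, e \in E -> x \in n e -> n e \subset [set y in rcons q u].
Proof.
move=> [[q0 uq _ _] maxt minp] pq sq hx e eE xe.
have q'0 : q' != [::].
  by rewrite -size_eq0 (perm_size pq) size_eq0.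
case: q' hx pq sq q'0 => //= x' q' -> pq sq _.
have xq : x \in q by rewrite -(perm_mem pq) mem_head.
have uq' : uniq ((x :: q') ++ u :: p).
  rewrite (perm_uniq (_ : perm_eq _ (q ++ u :: p))) //.
  by rewrite perm_cat2r.
have xin : x \in [set z in rcons q u] by rewrite inE mem_rcons inE xq orbT.
case: (link_or_loop eE xe) => [->|[y xy ->]]; first by rewrite sub1set.
rewrite subUset !sub1set xin /= inE mem_rcons inE.
have tq : size q = (size q').+1 by rewrite -(perm_size pq).
have [yin|yout] := boolP (y \in (x :: q') ++ u :: p); last first.
  have /maxt : lasso ([:: y], x, q' ++ u :: p).
    by split=> //=; rewrite ?yout // adj_sym xy.
  by rewrite /total /= size_cat /= tq add1n addnS addSn ltnn.
move: yin; rewrite mem_cat (perm_mem pq) inE => /or3P[->|->|yp]; rewrite ?orbT //.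
case/splitPr: yp sq uq' minp maxt {uq} => p1 p2 sq uq' minp _.
have /minp : lasso (x :: q' ++ u :: p1, y, p2).
  by split=> //=; rewrite -catA.
rewrite /total /= tq !size_cat /= => /(_ _).
have -> : (size q' + (size p1).+1).+1 + size p2 = (size q').+1 + (size p1 + (size p2).+1).
  by rewrite !addSn !addnS !addnA.
by move=> /(_ erefl); rewrite leqNgt ltn_addl.
Qed.

Let good_exchange C b d : hall_cycle n C -> C \subset E -> b \in E -> d \in E ->
    b \notin C -> d \notin C -> b != d -> n b \subset nbr n C -> n d \subset nbr n C ->
  exchange_pair.
Proof.
move=> cC CE bE dE bC dC bd sb sd.
exists (b |: C), (d |: C), b, d; split.
- by rewrite !subUset !sub1set bE dE CE.
- exact: chord_circuit (n_neq0 bE) sb.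
- exact: chord_circuit (n_neq0 dE) sd.
- apply/setP => g; rewrite !inE; have [->|gb] /= := eqVneq g b; last first.
    by case: (g \in C); rewrite ?orbT ?andbF.
  by rewrite (negPf bC) orbF bd.
apply/setP => g; rewrite !inE; have [->|gd] /= := eqVneq g d; last first.
  by case: (g \in C); rewrite ?orbT ?andbF.
by rewrite (negPf dC) orbF eq_sym bd.
Qed.

(** Once [u] is erased, [e] and [f] are two loops at [x]. *)
Let rooted_pair e f x u : e != f -> x != u -> n e = [set x; u] -> x \in n f ->
  n f \subset [set x; u] -> rooted_circuit n u [set e; f].
Proof.
move=> ef xu ne xf sf; have nbr2 : nbr n [set e; f] = [set x; u].
  by rewrite nbrU !nbr1 ne; apply/setUidPl.
split; last by rewrite nbr2 set22.
  rewrite nbr2 cards2 ef ltnS; apply: (@leq_trans #|[set x]|); last by rewrite cards1.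
  apply: subset_leq_card.
  by apply/subsetP => y; rewrite !inE => /andP[/negPf ->]; rewrite orbF.
move=> K pK; have [->|/set0Pn[g gK]] := eqVneq K set0; first by rewrite cards0.
have K1 : #|K| <= 1 by rewrite -ltnS; have := proper_card pK; rewrite cards2 ef.
apply: leq_trans K1 _; apply/card_gt0P; exists x; rewrite in_setD1 xu.
apply/nbrP; exists g => //.
by case/set2P: (subsetP (proper_sub pK) g gK) => -> //; rewrite ne set21.
Qed.

Let parallel_cycle e f x u : e != f -> x != u -> n e = [set x; u] -> n f = [set x; u] ->
  hall_cycle n [set e; f].
Proof.
move=> ef xu ne nf; split; first by rewrite nbrU !nbr1 ne nf setUid !cards2 ef xu.
  by apply/set0Pn; exists e; rewrite set21.
move=> K pK /set0Pn[g gK]; have := proper_card pK; rewrite cards2 ef ltnS => K1.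
apply: leq_ltn_trans K1 _; apply: leq_trans (subset_leq_card (sub_nbr n gK)).
by case/set2P: (subsetP (proper_sub pK) g gK) => ->; rewrite ?ne ?nf cards2 xu.
Qed.

(** The longest path ends in a bunch of parallel edges. *)
Let exchange_short x u p : extremal ([:: x], u, p) -> exchange_pair.
Proof.
move=> ext; have [[_ uq sq xu] _ _] := ext.
have xu' : x != u by case/andP: xu.
have fe e : e \in E -> x \in n e -> n e \subset [set x; u].
  move=> eE xe; apply: subset_trans (first_end ext (perm_refl _) sq erefl eE xe) _.
  by apply/subsetP => y; rewrite !inE.
have dich e : e \in E -> x \in n e -> n e = [set x] \/ n e = [set x; u].
  move=> eE xe; case: (link_or_loop eE xe) => [|[y /andP[xy _] ey]]; [by left|right].
  have : y \in n e by rewrite ey set22.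
  by move/(subsetP (fe e eE xe)); rewrite ey in_set2 eq_sym (negPf xy) => /eqP ->.
(* Among three edges at [x] at most one is a loop; the other two, parallel links to [u], are named
   [e1] and [e2]. *)
have [e1 [e2 [e3 [[e1s e2s e3s] [e12 e13 e23] [n1 n2']]]]] : exists e1 e2 e3,
    [/\ [/\ e1 \in star x, e2 \in star x & e3 \in star x],
        [/\ e1 != e2, e1 != e3 & e2 != e3] & n e1 = [set x; u] /\ n e2 = [set x; u]].
  have /card_gt2P[e [f [g [[es fs gs] [ef fg ge]]]]] := star_gt2 (adj_nbr xu).
  have [] := (es, fs, gs); rewrite !inE => -[/andP[eE xe] /andP[fE xf]] /andP[gE xg].
  case: (dich e eE xe) => ne; case: (dich f fE xf) => nf.
  - by case: (one_loop eE fE ef ne nf).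
  - case: (dich g gE xg) => ng; first by case: (one_loop gE eE ge ng ne).
    by exists f, g, e; rewrite fg ge eq_sym ef.
  - case: (dich g gE xg) => ng; first by case: (one_loop fE gE fg nf ng).
    by exists e, g, f; rewrite ef (eq_sym e) ge (eq_sym g) fg.
  by exists e, f, g; rewrite ef fg (eq_sym e) ge.
have in_star e : e \in star x -> e \in E /\ x \in n e by rewrite inE => /andP[].
have [[e1E x1] [e2E x2] [e3E x3]] := And3 (in_star _ e1s) (in_star _ e2s) (in_star _ e3s).
have starE : star x \subset E by apply/subsetP => e /in_star[].
(* With only three edges at [x], the star is a piece attached at [u]. With a fourth, [e1] and [e2]
   form a cycle that spans both [e3] and [e4]. *)
have [s3|s4] := leqP #|star x| 3.
  apply: (@end_exchange (star x) [set e1; e3] [set e2; e3] u e2 e1 e1 e2) => //.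
  - by rewrite eq_sym.
  - have s2 : #|star x :\ e1| <= 2 by move: s3; rewrite (cardsD1 e1) e1s.
    apply/hallP => K sK; apply: no_small; last exact: leq_trans (subset_leq_card sK) s2.
    by apply: subset_trans sK _; apply: subset_trans (subD1set _ _) starE.
  - move=> g gE gs; apply/subsetP => y; rewrite in_setI => /andP[yg /nbrP[e /in_star[eE xe]]].
    move/(subsetP (fe e eE xe)); rewrite !inE => /orP[/eqP yx|//].
    by case/negP: gs; rewrite inE gE -yx.
  - exact: rooted_pair e13 xu' n1 x3 (fe _ e3E x3).
  - exact: rooted_pair e23 xu' n2' x3 (fe _ e3E x3).
  - by rewrite subUset !sub1set e1s.
  - by rewrite subUset !sub1set e2s.
  - apply/setP => g; rewrite !inE; have [->|] := eqVneq g e1.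
      by rewrite (negPf e12) (negPf e13).
    by case: (g == e3); rewrite ?orbT ?andbF.
  apply/setP => g; rewrite !inE; have [->|] := eqVneq g e2.
    by rewrite eq_sym (negPf e12) (negPf e23).
  by case: (g == e3); rewrite ?orbT ?andbF.
have [e4 e4s e4n] : exists2 e4, e4 \in star x & e4 \notin [set e1; e2; e3].
  apply/subsetPn/negP => /subset_leq_card; rewrite leqNgt.
  by rewrite (leq_trans _ s4) // -setUA cardsU1 cards2 e23; case: (_ \notin _).
have [e4E x4] := in_star _ e4s.
move: e4n; rewrite !inE !negb_or -andbA => /and3P[e41 e42 e43].
apply: (@good_exchange [set e1; e2] e3 e4); rewrite ?nbrU ?nbr1 ?n1 ?n2' ?setUid ?fe //.
- exact: (@parallel_cycle _ _ x u).
- by rewrite subUset !sub1set e1E.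
- by rewrite in_set2 negb_or !(eq_sym e3) e13.
- by rewrite in_set2 negb_or e41.
- by rewrite eq_sym.
Qed.

Let rev_path_adj x q t : path adj x (rcons q t) -> path adj t (rcons (rev q) x).
Proof.
have := rev_path adj x (rcons q t); rewrite last_rcons belast_rcons rev_cons => ->.
by rewrite (@eq_path _ _ adj) // => y z; rewrite adj_sym.
Qed.

(** The vertices [x] and [z] next to [u] on the cycle each meet an edge spanned by the cycle but not
    on it. Unless two such edges differ, there is a single one, [b], joining [x] and [z]; this
    forces a triangle attached to the rest at [u] only. *)
Let exchange_long x q z u p : extremal (x :: rcons q z, u, p) -> exchange_pair.
Proof.
move=> ext; have [//|nex] := classic exchange_pair.
have [[_ uq sq xu] _ _] := ext; rewrite /= in xu.
pose c := rcons (x :: rcons q z) u.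
have uc : uniq c by move: uq; rewrite -cat_rcons cat_uniq => /andP[].
have [pc zu up] : [/\ path adj x (rcons q z), adj z u & path adj u p].
  by move: sq; rewrite /= cat_path last_rcons /= => /and3P[].
have cc : cycle adj c.
  by rewrite /c /= 2!rcons_path pc !last_rcons zu adj_sym xu.
have nextE y : y \in c -> adj y (next c y) by apply: next_cycle.
have c0 : c != [::] by [].
have xc : x \in c by rewrite inE eqxx.
have zc : z \in c by rewrite mem_rcons !inE mem_rcons inE eqxx !orbT.
have uc' : u \in c by rewrite mem_rcons inE eqxx.
have xz : x != z.
  by move: uc; rewrite /c /= !(mem_rcons, inE) !negb_or => /andP[/and3P[]].
have [e0 e0E _] : exists2 e0, e0 \in E & x \in n e0 by apply/nbrP/(adj_nbr xu).
(* The default [e0] is never taken for [y] on [c], where a suitable edge exists. *)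
pose phi y := odflt e0 [pick e in E | n e == [set y; next c y]].
have phiP y : y \in c -> phi y \in E /\ n (phi y) = [set y; next c y].
  move=> /nextE /andP[_ /existsP[e eP]]; rewrite /phi.
  by case: pickP => [f /andP[fE /eqP]|/(_ e)]; rewrite ?eP.
have phiE y : y \in c -> n (phi y) = [set y; next c y] by case/phiP.
(* Two vertices with the same edge would be successors of each other, but [c] has at least three
   vertices. *)
have phi_inj : {in c &, injective phi}.
  move=> y y' yc yc' eyy'; apply/eqP/negPn/negP => nyy'.
  have e2 : [set y; next c y] = [set y'; next c y'] by rewrite -!phiE // eyy'.
  have n1 : next c y = y'.
    have : y' \in [set y; next c y] by rewrite e2 set21.
    by rewrite in_set2 eq_sym (negPf nyy') => /eqP ->.
  have n2' : next c y' = y.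
    have : y \in [set y'; next c y'] by rewrite -e2 set21.
    by rewrite in_set2 (negPf nyy') => /eqP ->.
  have : size c <= 2.
    apply: (@uniq_leq_size _ c [:: y; y'] uc) => t.
    rewrite -(fconnect_cycle (cycle_next uc) yc) => /iter_findex <-.
    elim: (findex _ _ _) => [|k]; first by rewrite inE eqxx.
    by rewrite iterS !inE => /orP[]/eqP ->; rewrite ?n1 ?n2' eqxx ?orbT.
  by rewrite size_rcons /= size_rcons.
pose C := [set phi y | y in c].
have cC : hall_cycle n C by apply: vertex_cycle.
have CE : C \subset E by apply/subsetP => _ /imsetP[y yc ->]; case: (phiP y yc).
have nC : nbr n C = [set y in c] by apply: nbr_vertex_cycle.
(* Only [phi y] and [phi (prev c y)] are edges of [C] at [y]. *)
have third y : y \in c -> exists b, [/\ b \in E, y \in n b & b \notin C].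
  move=> yc; have s3 := star_gt2 (adj_nbr (nextE y yc)).
  have /subsetPn[b] : ~~ (star y \subset C).
    apply: contraL s3 => sC; rewrite -leqNgt.
    apply: leq_trans (subset_leq_card _) (_ : #|[set phi y; phi (prev c y)]| <= 2).
      apply/subsetP => e es; have /imsetP[t tc et] := subsetP sC e es.
      move: es; rewrite inE et phiE // !inE => /andP[_ /orP[]/eqP ->].
        by rewrite eqxx.
      by rewrite prev_next // eqxx orbT.
    by rewrite cards2; case: (_ != _).
  by rewrite inE => /andP[bE yb] bC; exists b.
have unique_chord b d : b \in E -> d \in E -> b \notin C -> d \notin C ->
    n b \subset [set y in c] -> n d \subset [set y in c] -> b = d.
  move=> bE dE bC dC sb sd; apply/eqP/negPn/negP => bd; apply: nex.
  by apply: (good_exchange cC CE bE dE); rewrite ?nC.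
have fx := first_end ext (perm_refl _) sq erefl.
(* Reversing the part before [u] gives a path starting at [z], because [x] is adjacent to [u]. *)
have fz : forall e, e \in E -> z \in n e -> n e \subset [set y in c].
  apply: (@first_end _ _ _ (z :: rcons (rev q) x) z ext) => //.
    by rewrite -rev_cons -rev_rcons perm_rev.
  by rewrite /= cat_path rev_path_adj // last_rcons /= xu up.
have [b [bE xb bC]] := third x xc; have sb := fx b bE xb.
have [d [dE zd dC]] := third z zc; have sd := fz d dE zd.
have ebd := unique_chord b d bE dE bC dC sb sd.
have zb : z \in n b by rewrite ebd.
have nb : n b = [set x; z].
  apply/esym/eqP; rewrite eqEcard subUset !sub1set xb zb /=.
  by apply: leq_trans (n2 b) _; rewrite cards2 xz.
have xz' : adj x z by apply/andP; split=> //; apply/existsP; exists b; rewrite bE nb eqxx.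
(* If a vertex [t] precedes [z], going back from [t] to [x], along [b] to [z] and on to [u] makes
   [t] a first end as well. The edge it then meets must be [b], whose ends are [x] and [z]. *)
case/lastP: q => [|q t] in ext uq sq c uc pc cc nextE c0 xc zc uc' phi phiP phiE phi_inj
    C cC CE nC third unique_chord fx fz bC sb dC sd *; last first.
  have tc : t \in c by rewrite !(mem_rcons, inE) eqxx !orbT.
  have ft : forall e, e \in E -> t \in n e -> n e \subset [set y in c].
    apply: (@first_end _ _ _ (rcons (t :: rcons (rev q) x) z) t ext) => //.
      rewrite -rev_cons -rev_rcons -[x :: rcons (rcons q t) z]/(rcons (x :: rcons q t) z).
      by rewrite perm_rcons perm_sym perm_rcons perm_cons perm_sym perm_rev.
    move: pc; rewrite rcons_path last_rcons => /andP[pc tz].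
    by rewrite /= cat_path rcons_path !last_rcons rev_path_adj // xz' /= zu up.
  have [d' [dE' td' dC']] := third t tc.
  have ebd' := unique_chord b d' bE dE' bC dC' sb (ft d' dE' td').
  move: td'; rewrite -ebd' nb in_set2; move: uc.
  rewrite /c /= !rcons_uniq !(mem_rcons, inE) !negb_or.
  case/and3P=> /and4P[_ _ xt _] _ /and3P[/andP[zt _] _ _].
  by rewrite eq_sym (negPf xt) eq_sym (negPf zt).
(* Now [c] is the triangle on [x], [z], [u], and [b] is parallel to [phi x]; replacing one by the
   other gives two triangles through [u]. *)
pose phi2 y := if y == x then b else phi y.
have phi2E y : y \in c -> n (phi2 y) = [set y; next c y].
  move=> yc; rewrite /phi2; case: eqP => [->|_]; last exact: phiE.
  by rewrite nb /c /= eqxx.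
have phib y : y \in c -> phi y != b.
  by move=> yc; apply: contraNneq bC => <-; apply: imset_f.
have phi2_inj : {in c &, injective phi2}.
  move=> y y' yc yc'; rewrite /phi2; case: eqP => [->|_]; case: eqP => [->|_] //.
  - by move/esym/eqP; rewrite (negPf (phib _ _)).
  - by move/eqP; rewrite (negPf (phib _ _)).
  exact: phi_inj.
have cC2 := vertex_cycle uc c0 phi2_inj phi2E.
have nC2 := nbr_vertex_cycle phi2E.
set C2 := [set phi2 y | y in c] in cC2 nC2.
have C2H : C2 \subset b |: C.
  apply/subsetP => _ /imsetP[y yc ->]; rewrite /phi2; case: eqP => _; first exact: setU11.
  by rewrite in_setU1 imset_f ?orbT.
apply: (@end_exchange (b |: C) C C2 u (phi x) b (phi x) b).
- by rewrite subUset sub1set bE.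
- by rewrite in_setU1 imset_f ?orbT.
- exact: setU11.
- exact: phib.
- by rewrite setU1K //; apply: hall_cycle_hall.
- move=> g gE gH; apply/subsetP => y; rewrite in_setI nbrU1 nC (setUidPr sb).
  have bg : g = b -> false by move=> e; rewrite e setU11 in gH.
  have gC : g \notin C by apply: contra gH => gC; rewrite in_setU1 gC orbT.
  case/andP=> yg; rewrite !inE => /or3P[/eqP yx|/eqP yz|//].
    rewrite yx in yg.
    by have := bg (unique_chord g b gE bE gC bC (fx g gE yg) sb).
  rewrite yz in yg.
  by have := bg (unique_chord g b gE bE gC bC (fz g gE yg) sb).
- by apply: hall_cycle_rooted; rewrite // nC inE.
- by apply: hall_cycle_rooted; rewrite // nC2 inE.
- exact: subsetUr.
- exact: C2H.
- apply/setP => e; rewrite in_setD in_set1; apply/andP/eqP => [[eC2 /imsetP[y yc ey]]|->].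
    rewrite ey; congr phi; apply/eqP; apply: contraNT eC2 => yx.
    by apply/imsetP; exists y; rewrite // /phi2 (negPf yx).
  split; last exact: imset_f.
  apply/imsetP => -[y yc]; rewrite /phi2; case: eqP => [_|yx] exy.
    by case/eqP: (phib x xc).
  by case: yx; apply: phi_inj.
apply/setP => e; rewrite in_setD in_set1; apply/andP/eqP => [[eC /imsetP[y yc ey]]|->].
  move: ey; rewrite /phi2; case: eqP => // _ ey; rewrite ey imset_f // in eC.
by split=> //; apply/imsetP; exists x; rewrite // /phi2 eqxx.
Qed.

Lemma exchange_exists : E != set0 -> exchange_pair.
Proof.
case/extremal_exists => -[[[|x q] u] p] ext; first by case: ext => -[].
case/lastP: q ext => [|q z] ext; first exact: exchange_short ext.
exact: exchange_long ext.
Qed.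

End Exchange.

(** * Bicircular matroids *)

Section BicircularHall.
Variable G : graph.
Implicit Types (e f x : edge G) (u v w : vertex G) (I J K L C : {set edge G}).

Definition end_set e : {set vertex G} := [set (ends e).1; (ends e).2].

Local Notation nbr := (nbr end_set).

Lemma end_set_neq0 e : end_set e != set0.
Proof. by apply/set0Pn; exists (ends e).1; rewrite set21. Qed.

Lemma card_end_set e : #|end_set e| <= 2.
Proof. by rewrite cards2; case: (_ != _). Qed.

Lemma incidence_gt0 e v : (0 < incidence e v) = (v \in end_set e).
Proof. by rewrite addn_gt0 !lt0b in_set2 ![v == _]eq_sym. Qed.

Lemma vertices_nbr I : vertices I = nbr I.
Proof.
apply/setP => v; rewrite inE; apply/exists_inP/nbrP => -[e eI].
  by rewrite incidence_gt0; exists e.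
by exists e; rewrite ?incidence_gt0.
Qed.

Lemma degree_notin J v : v \notin nbr J -> degree J v = 0.
Proof.
move=> vJ; apply: big1 => e eJ; apply/eqP; rewrite -leqn0 leqNgt incidence_gt0.
by apply: contra vJ => ve; apply/nbrP; exists e.
Qed.

Lemma sum_degree J (U : {set vertex G}) :
  \sum_(v in U) degree J v =
  \sum_(e in J) (((ends e).1 \in U) + ((ends e).2 \in U)).
Proof.
have delta w : \sum_(v in U) nat_of_bool (w == v) = (w \in U).
  rewrite (eq_bigr (fun v => if w == v then 1 else 0)); last by move=> v _; case: eqP.
  rewrite -big_mkcondr; have [wU|wU] := boolP (w \in U).
    rewrite (big_pred1 w) // => v; rewrite [RHS]eq_sym andbC.
    by case: (eqVneq w v) => [<-|].
  by rewrite big_pred0 // => v; apply/negP => /andP[vU /eqP wv]; rewrite wv vU in wU.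
rewrite exchange_big; apply: eq_bigr => e _.
by rewrite big_split /= !delta.
Qed.

Lemma adjacent_sym I : symmetric (adjacent I).
Proof.
by move=> u v; rewrite /adjacent; apply: eq_existsb => e; rewrite orbC.
Qed.

Lemma connect_ends I e v w : e \in I -> w \in end_set e ->
  connect (adjacent I) v w = connect (adjacent I) v (ends e).1.
Proof.
move=> eI; have adj12 : adjacent I (ends e).1 (ends e).2.
  by apply/exists_inP; exists e => //; case: (ends e) => a b; rewrite eqxx.
rewrite in_set2 => /orP[]/eqP -> //; apply/esym.
by apply: (same_connect_r (sym_connect_sym (adjacent_sym I))); apply: connect1.
Qed.

(** An edge sharing a vertex with the component belongs to it, so the two vertex sets are
    disjoint. *)
Lemma card_component_split J v :
  #|nbr J| = #|nbr (component J v)| + #|nbr (J :\: component J v)|.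
Proof.
have sub : component J v \subset J by apply/subsetP => e; rewrite inE => /andP[].
rewrite -{1}(setID J (component J v)) (setIidPr sub) nbrU.
apply/eqP; rewrite (leq_card_setU _ _) -setI_eq0; apply/eqP/setP => w.
rewrite in_setI in_set0; apply/negP => /andP[/nbrP[e + we] /nbrP[f + wf]].
rewrite in_setD !inE => /andP[eJ ve] /andP[nf fJ]; case/negP: nf; rewrite fJ /=.
by rewrite -(connect_ends v fJ wf) (connect_ends v eJ we).
Qed.

(** A minimal nonempty edge set with no more vertices than edges is a cycle. *)
Lemma exists_cycle J : J != set0 -> #|nbr J| <= #|J| ->
  exists2 C : {set edge G}, C \subset J & is_cycle C.
Proof.
move=> J0 le; pose P (K : {set edge G}) := (K != set0) && (#|nbr K| <= #|K|).
have [C /minsetP[/andP[C0 leC] minC] sCJ] := @minset_exists _ P J (introT andP (conj J0 le)).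
have big L : L \proper C -> L != set0 -> #|L| < #|nbr L|.
  move=> pL L0; rewrite ltnNge; apply/negP => leL.
  have eL : L = C by apply: minC; rewrite ?proper_sub // /P L0.
  by rewrite eL properxx in pL.
have [x xC] := set0Pn _ C0.
have nbrC : #|nbr C| = #|C|.
  apply/eqP; rewrite eqn_leq leC /=; have [e|ne] := eqVneq (C :\ x) set0.
    rewrite (cardsD1 x) xC e cards0; apply: leq_trans (subset_leq_card (sub_nbr _ xC)).
    by rewrite card_gt0 end_set_neq0.
  rewrite (cardsD1 x) xC; apply: leq_trans (big _ (properD1 xC) ne) _.
  by apply/subset_leq_card/nbrS/subD1set.
exists C => //; apply/and3P; split=> //.
  set v := (ends x).1.
  have sub : component C v \subset C by apply/subsetP => e; rewrite inE => /andP[].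
  have xK : x \in component C v by rewrite inE xC connect0.
  (* Otherwise both parts are proper and the strict surplus of the component contradicts [nbrC]. *)
  have eC : C :\: component C v = set0.
    apply/eqP/negPn/negP => D0.
    have pK : component C v \proper C.
      by rewrite properE sub /= -setD_eq0.
    have pD : C :\: component C v \proper C.
      by apply/properP; split; [apply: subsetDl|exists x; rewrite // in_setD xK].
    have K0 : component C v != set0 by apply/set0Pn; exists x.
    have := leq_add (big _ pK K0) (ltnW (big _ pD D0)).
    rewrite -card_component_split nbrC addSn.
    by rewrite -{1}(cardsID (component C v) C) (setIidPr sub) ltnn.
  have conn w : w \in vertices C -> connect (adjacent C) v w.
    rewrite vertices_nbr => /nbrP[e eC' we]; rewrite (connect_ends v eC' we).
    have : e \in component C v.
      by apply/negPn/negP => ne; have := in_set0 e; rewrite -eC in_setD ne eC'.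
    by rewrite inE => /andP[].
  apply/forall_inP => u /conn cu; apply/forall_inP => w /conn; apply: connect_trans.
  by rewrite (sym_connect_sym (adjacent_sym C)).
(* A vertex of degree one could be deleted with its edge, against minimality; if no edge is left,
   that edge is a loop, which counts twice. *)
have deg2 v : v \in nbr C -> 2 <= degree C v.
  move=> vC; rewrite ltnNge; apply/negP; case/nbrP: (vC) => e eC ve.
  rewrite /degree (bigD1 e) //= => le1.
  have ie : 0 < incidence e v by rewrite incidence_gt0.
  have [ie1 rest] : incidence e v = 1 /\ \sum_(i in C | i != e) incidence i v = 0.
    by move: le1 ie; case: (incidence e v) => [|[|k]] //; rewrite add1n ltnS leqn0 => /eqP.
  have sD : nbr (C :\ e) \subset nbr C :\ v.
    apply/subsetP => w /nbrP[f /setD1P[fe fC] wf]; rewrite in_setD1; apply/andP; split.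
      apply: contraTneq wf => ->; rewrite -incidence_gt0 -leqNgt.
      by rewrite -rest (bigD1 f) ?fC //= leq_addr.
    by apply/nbrP; exists f.
  have cD : #|nbr (C :\ e)| <= #|C :\ e|.
    rewrite -ltnS; apply: leq_ltn_trans (subset_leq_card sD) _.
    by move: nbrC; rewrite (cardsD1 v) vC (cardsD1 e C) eC !add1n => -[->].
  have [D0|D0] := eqVneq (C :\ e) set0; last first.
    by have := big _ (properD1 eC) D0; rewrite ltnNge cD.
  have n1 : #|end_set e| <= 1.
    apply: leq_trans (subset_leq_card (sub_nbr _ eC)) _.
    by rewrite nbrC (cardsD1 e) eC D0 cards0.
  move: n1 ve ie1; rewrite cards2 /incidence in_set2; case: eqP => // -> _.
  by rewrite orbb eq_sym => ->.
(* The degrees sum to twice the number of edges, which is the number of vertices; being at least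
   two, all are equal to two. *)
have sumE : \sum_(v in nbr C) 2 = \sum_(v in nbr C) degree C v.
  rewrite sum_degree big_const iter_addn_0 nbrC mulnC -sum_nat_const.
  apply: eq_bigr => e eC; have sub := subsetP (sub_nbr end_set eC).
  by rewrite !sub ?set21 ?set22.
have [_] := leqif_sum (fun v (vC : v \in nbr C) => leqif_eq (deg2 v vC)).
rewrite sumE eqxx => /esym /forall_inP degE.
by apply/forall_inP => v; rewrite vertices_nbr => /degE; rewrite eq_sym.
Qed.

(** Given an edge [x] of the cycle [C2] outside the cycle [C1], grow [C1] inside the component
    without [x] as long as vertices do not outnumber edges. Parity along [C2] puts both ends of [x]
    or neither in the result: both violates Hall's condition, neither contradicts connectedness. *)
Lemma hall_indep I : hall end_set I -> I \in indep (bicircular G).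
Proof.
move=> hI; rewrite inE; apply/forall_inP => K /imsetP[v0 _ ->].
set K0 := component I v0.
have sKI : K0 \subset I by apply/subsetP => e; rewrite inE => /andP[].
have key C1 C2 : is_cycle C1 -> C1 \subset K0 -> is_cycle C2 -> C2 \subset K0 ->
    C2 \subset C1.
  move=> cyc1 s1 cyc2 s2; apply/negPn/negP => /subsetPn[x xC2 xC1].
  have tight C : is_cycle C -> #|nbr C| = #|C|.
    case/and3P => _ _ /forall_inP deg.
    have : \sum_(v in nbr C) degree C v = \sum_(v in nbr C) 2.
      by apply: eq_bigr => v vC; apply/eqP/deg; rewrite vertices_nbr.
    rewrite sum_degree [RHS]big_const iter_addn_0 mulnC.
    rewrite (eq_bigr (fun=> 2)); first by rewrite sum_nat_const; lia.
    move=> e eC; have sub := subsetP (sub_nbr end_set eC).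
    by rewrite !sub ?set21 ?set22.
  pose P (L : {set edge G}) := (L \subset K0 :\ x) && (#|nbr L| <= #|L|).
  have P1 : P C1 by rewrite /P subsetD1 s1 xC1 (tight _ cyc1) /=.
  have [J /maxsetP[/andP[sJ leJ] maxJ] C1J] := maxset_exists P1.
  have /andP[sJK xJ] : (J \subset K0) && (x \notin J) by rewrite -subsetD1.
  (* An edge already touching [nbr J] brings at most one new vertex, so maximality absorbs it. *)
  have grow e w : e \in K0 -> e != x -> w \in end_set e -> w \in nbr J -> e \in J.
    move=> eK ex we wJ; apply/negPn/negP => eJ.
    have : P (e |: J).
      rewrite /P subUset sub1set in_setD1 ex eK sJ /= nbrU1 cardsU1 eJ add1n.
      have : #|end_set e :|: nbr J| = #|nbr J| + #|end_set e :\: nbr J|.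
        rewrite -[LHS](cardsID (nbr J)); congr (_ + _).
          by rewrite (setIidPr (subsetUr _ _)).
        by rewrite setDUl setDv setU0.
      move=> ->; rewrite -addn1 leq_add //.
      rewrite -ltnS; apply: leq_trans (card_end_set e); apply: proper_card.
      by apply/properP; split; [apply: subsetDl|exists w; rewrite // in_setD wJ].
    by move/maxJ => /(_ (subsetUr _ _)) eqJ; rewrite -eqJ setU11 in eJ.
  have xK : x \in K0 by apply: (subsetP s2).
  have xI : x \in I by apply: (subsetP sKI).
  have inner e w : e \in J -> w \in end_set e -> w \in nbr J.
    by move=> eJ; apply: (subsetP (sub_nbr _ eJ)).
  have C1neq : C1 != set0 by case/and3P: cyc1.
  have [y yC1] := set0Pn _ C1neq.
  have yJ : y \in J by apply: (subsetP C1J).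
  pose U := nbr J.
  (* All degrees of [C2] in [U] are even and [x] is the only edge of [C2] that can
     have exactly one end in [U]. *)
  have parity : ((ends x).1 \in U) = ((ends x).2 \in U).
    have even : ~~ odd (\sum_(v in U) degree C2 v).
      apply: (big_ind (fun k => ~~ odd k)) => // [a b|v _].
        by rewrite oddD => /negPf -> /negPf ->.
      have [vC|/degree_notin -> //] := boolP (v \in nbr C2).
      case/and3P: cyc2 => _ _ /forall_inP/(_ v).
      by rewrite vertices_nbr => /(_ vC) /eqP ->.
    move: even; rewrite sum_degree (bigD1 x) //= oddD.
    have -> : odd (\sum_(e in C2 | e != x)
        (((ends e).1 \in U) + ((ends e).2 \in U))) = false.
      apply/negbTE; apply: (big_ind (fun k => ~~ odd k)) => // [a b|e /andP[eC ex]].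
        by rewrite oddD => /negPf -> /negPf ->.
      have eK := subsetP s2 e eC.
      case: (boolP ((ends e).1 \in U)) => U1.
        have eJ : e \in J by apply: grow eK ex _ U1; rewrite set21.
        by rewrite (inner e) ?set22.
      case: (boolP ((ends e).2 \in U)) => // U2.
      have eJ : e \in J by apply: grow eK ex _ U2; rewrite set22.
      by rewrite (inner e) ?set21 in U1.
    by rewrite addbF; case: (_ \in _) (_ \in _) => [] [].
  have [xU|xU] := boolP ((ends x).1 \in U).
    have sJI : x |: J \subset I.
      by rewrite subUset sub1set xI; apply: subset_trans sJK sKI.
    have := hallP _ _ hI _ sJI; rewrite nbrU1 cardsU1 xJ add1n.
    have /setUidPr -> : end_set x \subset nbr J.
      by rewrite subUset !sub1set -/U -parity xU.
    by move=> lt; have := leq_trans lt leJ; rewrite ltnn.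
  have closedU w w' : adjacent I w w' -> connect (adjacent I) v0 w -> w \in U -> w' \in U.
    case/exists_inP => e eI eww vw wU.
    have [we we'] : w \in end_set e /\ w' \in end_set e.
      by case/orP: eww => /eqP eqe; rewrite /end_set eqe /= set21 set22.
    have eK : e \in K0 by rewrite inE eI -(connect_ends v0 eI we).
    have ex : e != x.
      apply: contraTneq wU => eqx; move: we; rewrite eqx in_set2 => /orP[]/eqP -> //.
      by rewrite -parity.
    by apply: (inner e) => //; apply: grow eK ex we wU.
  have yK : y \in K0 by apply: (subsetP sJK).
  have vy : connect (adjacent I) v0 (ends y).1 by move: yK; rewrite inE => /andP[].
  have vx : connect (adjacent I) v0 (ends x).1 by move: xK; rewrite inE => /andP[].
  have yx : connect (adjacent I) (ends y).1 (ends x).1.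
    by apply: connect_trans vx; rewrite (sym_connect_sym (adjacent_sym I)).
  have yU : (ends y).1 \in U by apply: (inner y); rewrite ?set21.
  case/connectP: yx => p pp lastp; case/negP: xU; rewrite lastp {lastp}.
  elim: p (ends y).1 vy yU pp => //= w p IH v vv vU /andP[vw pw].
  apply: IH => //; last exact: closedU vw vv vU.
  exact: connect_trans vv (connect1 vw).
apply/forallP => C1; apply/forallP => C2; apply/implyP => /and4P[c1 s1 c2 s2].
by rewrite eqEsubset (key C2 C1 c2 s2 c1 s1) (key C1 C2 c1 s1 c2 s2).
Qed.

(** A minimal violation [K] is connected, as otherwise one of its parts would be deficient. It has
    so many edges that a cycle remains after deleting an edge [x] of a first cycle, so one component
    of [I] contains two cycles. *)
Lemma indep_hall I : I \in indep (bicircular G) -> hall end_set I.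
Proof.
rewrite inE => /forall_inP one; apply/negPn/negP => /hall_circuit_exists[K [ltK hK] sKI].
have K0 : K != set0 by rewrite -card_gt0; apply: leq_ltn_trans ltK.
have [C1 s1 cyc1] := exists_cycle K0 (ltnW ltK).
have /set0Pn[x xC1] : C1 != set0 by case/and3P: cyc1.
have xK := subsetP s1 x xC1; set v := (ends x).1.
have [||C2 s2 cyc2] := @exists_cycle (K :\ x).
- apply: contraTneq ltK => D0; rewrite -leqNgt (cardsD1 x) xK D0 cards0 card_gt0.
  by apply/set0Pn; exists v; apply/nbrP; exists x; rewrite // set21.
- move: ltK; rewrite (cardsD1 x K) xK add1n ltnS; apply: leq_trans.
  by apply/subset_leq_card/nbrS/subD1set.
have sub : component K v \subset K by apply/subsetP => e; rewrite inE => /andP[].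
have xcomp : x \in component K v by rewrite inE xK connect0.
have eK : K :\: component K v = set0.
  apply/eqP/negPn/negP => D0.
  have pK : component K v \proper K by rewrite properE sub /= -setD_eq0.
  have pD : K :\: component K v \proper K.
    by apply/properP; split; [apply: subsetDl|exists x; rewrite // in_setD xcomp].
  have := leq_add (hK _ pK) (hK _ pD).
  have -> : #|component K v| + #|K :\: component K v| = #|K|.
    by rewrite -[RHS](cardsID (component K v)) (setIidPr sub).
  by rewrite -card_component_split leqNgt ltK.
have sKC : K \subset component I v.
  apply/subsetP => e eK'; rewrite inE (subsetP sKI) //=.
  have : e \in component K v.
    by apply/negPn/negP => ne; have := in_set0 e; rewrite -eK in_setD ne eK'.
  rewrite inE => /andP[_]; apply: connect_sub => a b /exists_inP[f fK fab].
  by apply: connect1; apply/exists_inP; exists f; rewrite ?(subsetP sKI).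
have /one/forallP/(_ C1)/forallP/(_ C2) : component I v \in components I.
  apply: imset_f; rewrite vertices_nbr; apply/nbrP.
  by exists x; rewrite ?(subsetP sKI) // set21.
rewrite cyc1 cyc2 (subset_trans s1 sKC) /=.
rewrite (subset_trans s2 (subset_trans (subD1set _ _) sKC)) /= => /eqP e12.
by have := subsetP s2 x; rewrite -e12 => /(_ xC1); rewrite in_setD1 eqxx.
Qed.

End BicircularHall.

(** * Passage to the minor and conclusion *)

Lemma cosimple_basis (T : finType) (M : matroid T) e f :
    set0 \in indep M -> cosimple M -> e \in ground M -> f \in ground M ->
  exists2 B, B \in bases M & e \notin B /\ f \notin B.
Proof.
move=> i0 [no1 no2] eM fM; set S := [set e; f].
have SM : S \subset ground M by rewrite subUset !sub1set eM.
have [iS|dS] := boolP (S \in indep (dual M)).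
  move: iS; rewrite inE => /exists_inP[_ /imsetP[B BM ->]] sS; exists B => //.
  by move: sS; rewrite subUset !sub1set !in_setD => /andP[/andP[-> _] /andP[-> _]].
(* A circuit of the dual inside [[set e; f]] would be a loop or a parallel pair. *)
have [C minC sCS] := @minset_exists _
  (fun D : {set T} => (D \subset ground M) && (D \notin indep (dual M))) S
  (introT andP (conj SM dS)).
have cC : C \in circuits (dual M) by rewrite inE.
have [B /[dup] mB /maxsetP[iB _] _] := maxset_exists i0.
have /set0Pn[a aC] : C != set0.
  apply: contraTneq (minsetp minC) => ->; rewrite negb_and negbK inE orbC.
  apply/orP; left; apply/exists_inP; exists (ground M :\: B); rewrite ?sub0set //.
  by apply: imset_f; rewrite inE.
have [C1|/set0Pn[b bC]] := eqVneq (C :\ a) set0.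
  by case/negP: (no1 a); rewrite -(setU0 [set a]) -C1 setD1K.
have /setD1P[ba bC'] := bC; rewrite eq_sym in ba.
case/negP: (no2 a b ba).
suff -> : [set a; b] = C by [].
apply/eqP; rewrite eqEcard subUset !sub1set aC bC' /= cards2 ba.
by apply: leq_trans (subset_leq_card sCS) _; rewrite cards2; case: (_ != _).
Qed.

Lemma circuit_flow (T : finType) (O : signed_system T) X :
    X \in scircuits O -> supp X != set0 -> #|supp X| <= 2 ->
  exists f : {ffun T -> int},
    [/\ is_flow O f, sign_valued f, f <> 0%R & #|[set e | f e != 0%R]| <= 2].
Proof.
move=> XO /set0Pn[e eX] X2; exists (signed_vector X); split.
- exact: flow_circuit.
- by move=> h; apply: sv_values.
- by move=> f0; move: eX; rewrite -sv_neq0 f0 ffunE eqxx.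
by rewrite (eq_card (_ : _ =i supp X)) // => h; rewrite in_set sv_neq0.
Qed.

Theorem proposition19 (G : graph) (O : signed_system (edge G)) :
  oriented_matroid O -> underlying O = bicircular G -> coGSP O.
Proof.
move=> oO uO O' [A [B0 [_ _ _ eO']]] cosO' E0.
have oO' : oriented_matroid O'.
  by rewrite eO'; apply/delete_oriented/contract_oriented.
have sO : sground O = setT by have := f_equal (@ground _) uO.
have freeE (I : {set edge G}) : circuit_free O I = hall (@end_set G) I.
  have -> : circuit_free O I = (I \in indep (underlying O)) by rewrite inE sO subsetT.
  by rewrite uO; apply/idP/idP => [/indep_hall|/hall_indep].
have [I0 [sI0 fI0 maxI0]] := circuit_free_basis A oO.
have [|n [n2 hn]] := hall_contract (@card_end_set G) (I := I0); first by rewrite -freeE.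
set E := sground O' in E0 *.
have sE (J : {set edge G}) : J \subset E -> [disjoint J & A].
  move=> sJ; apply: disjointWl sJ _; rewrite /E eO' /= disjoints_subset.
  by apply: subset_trans (subsetDl _ _) _; rewrite setDE subsetIr.
(* Deletion keeps the circuits inside [E], contraction amounts to adding the basis [I0], and the
   family [n] absorbs [I0]. *)
have freeO' (J : {set edge G}) : J \subset E -> circuit_free O' J = hall n J.
  move=> sJ; have dJA := sE J sJ.
  rewrite -hn; last exact: disjointWr dJA.
  rewrite -freeE -(contract_free oO sI0 fI0 maxI0 dJA).
  apply/forall_inP/forall_inP => fJ X XO; last first.
    by apply: fJ; move: XO; rewrite eO' in_set => /andP[].
  apply/negP => sX; have XO' : X \in scircuits O'.
    rewrite eO' in_set XO; apply: subset_trans sX _.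
    by move: sJ; rewrite /E eO'.
  by have := fJ X XO'; rewrite sX.
have dep (J : {set edge G}) : J \subset E -> ~~ hall n J ->
    exists2 X, X \in scircuits O' & supp X \subset J.
  by move=> sJ; rewrite -freeO' // => /forall_inPn[X XO]; rewrite negbK; exists X.
have [[K [sK K2 ltK]]|no_small] := classic (exists K : {set edge G},
    [/\ K \subset E, #|K| <= 2 & #|nbr n K| < #|K|]).
  have [X XO sX] : exists2 X, X \in scircuits O' & supp X \subset K.
    apply: dep => //; apply/hallP => /(_ K (subxx _)); by rewrite leqNgt ltK.
  apply: (circuit_flow XO); first exact: om_nonempty oO' _ XO.
  by apply: leq_trans (subset_leq_card sX) K2.
have indepE (J : {set edge G}) : (J \in indep (underlying O')) = (J \subset E) && circuit_free O' J.
  by rewrite inE.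
have cosE e f : e \in E -> f \in E -> exists B : {set edge G},
    [/\ B \subset E, hall n B, e \notin B, f \notin B &
      forall g, g \in E -> hall n (g |: B) -> g \in B].
  move=> eE fE; have [|B] := cosimple_basis _ cosO' eE fE.
    rewrite indepE sub0set /=; apply/forall_inP => X XO.
    by rewrite subset0 (om_nonempty oO').
  rewrite inE => /maxsetP[]; rewrite indepE => /andP[sB fB] maxB [eB fB'].
  exists B; split=> //; first by rewrite -freeO'.
  move=> g gE hg; rewrite -(maxB (g |: B)) ?subsetUr ?setU11 //.
  have sgB : g |: B \subset E by rewrite subUset sub1set gE.
  by rewrite indepE sgB freeO'.
have [|C1 [C2 [e [f [[s1 s2] c1 c2 d12 d21]]]]] := exchange_exists n2 cosE _ E0.
  move=> K sK K2; rewrite leqNgt; apply/negP => ltK; apply: no_small.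
  by exists K.
(* A signed circuit inside [C] fills it, because proper subsets of [C] satisfy Hall's condition and
   so are circuit-free. *)
have real (C : {set edge G}) : C \subset E -> hall_circuit n C ->
    exists2 X, X \in scircuits O' & supp X = C.
  move=> sC [ltC minC]; have [|X XO sX] := dep C sC.
    by apply/hallP => /(_ C (subxx _)); rewrite leqNgt ltC.
  exists X => //; apply/eqP; move: (sX); rewrite subEproper => /orP[//|pX].
  have sXE := subset_trans sX sC.
  have : circuit_free O' (supp X).
    rewrite freeO' //; apply/hallP => K sK; apply: minC.
    by apply: sub_proper_trans sK pX.
  by move/circuit_freeN => /(_ X XO (subxx _)).
have [X XO eX] := real C1 s1 c1; have [Y YO eY] := real C2 s2 c2.
by apply: (exchange_flow oO' XO YO (e := e) (f := f)); rewrite eX eY.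
Qed.
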